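(* Let $m, M\geq 1$ be integers. Suppose $f : \mathbb{B}^m\rightarrow \mathbb{B}^M$ is a proper holomorphic map that extends to an $\alpha$-Hölder continuous map $\overline{\mathbb{B}^m} \rightarrow \overline{\mathbb{B}^M}$ (also denoted $f$) for some $\alpha > 1/2$. If $(\phi,\psi) \in \mathsf{G}_f$ and $\phi$ is loxodromic, then $\psi$ is loxodromic. Moreover, $$f\left(L_{\phi} \cap \overline{\mathbb{B}^m} \right) \subset L_{\psi} \cap \overline{\mathbb{B}^M}.$$
   Context: $\mathbb{B}^d \subset \mathbb{C}^d$ is the open Euclidean unit ball, and $\mathsf{Aut}(\mathbb{B}^d)$ is the group of biholomorphic maps $\mathbb{B}^d\to\mathbb{B}^d$. Every element of $\mathsf{Aut}(\mathbb{B}^d)$ extends to a smooth map $\overline{\mathbb{B}^d}\to\overline{\mathbb{B}^d}$. For a holomorphic map $f:\mathbb{B}^m\to\mathbb{B}^M$, the symmetry group of $f$ is $$\mathsf{G}_f := \{(\phi,\varphi)\in \mathsf{Aut}(\mathbb{B}^m)\times\mathsf{Aut}(\mathbb{B}^M) : f = \varphi\circ f\circ\phi^{-1}\}.$$ An element $g\in\mathsf{Aut}(\mathbb{B}^d)$ is loxodromic if it has no fixed point in $\mathbb{B}^d$ and (its extension) fixes exactly two points in $\partial\mathbb{B}^d$. A complex affine line in $\mathbb{C}^d$ is a set $a+\mathbb{C}\cdot b$ with $a,b\in\mathbb{C}^d$, $b\neq 0$. For $g$ loxodromic, $L_g\subset\mathbb{C}^d$ denotes the complex affine line containing the two fixed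 points of $g$ in $\partial\mathbb{B}^d$. *)

(* Defs.v *)
From HB Require Import structures.
From mathcomp Require Import all_boot all_order all_algebra.
From mathcomp Require Import all_classical all_reals topology normedtype derive.
From mathcomp Require Import exp.
From mathcomp Require Import complex.

Set Implicit Arguments.
Unset Strict Implicit.
Unset Printing Implicit Defensive.

Import Order.TTheory GRing.Theory Num.Theory.
Import numFieldNormedType.Exports.
Local Open Scope classical_set_scope.
Local Open Scope ring_scope.

(* The topology of R[i] given by its modulus, as the library does for its
   abstract number fields in [numFieldNormedType]. *)
#[export, non_forgetful_inheritance]
HB.instance Definition _ (R : realType) := NormedModule.copy R[i] R[i]^o.

(* C^d is 'rV[R[i]]_d.  Its library norm is the sup norm, which gives the usual
   topology and the usual (complex) differentiability; the unit ball and the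
   Hölder condition need the Euclidean norm. *)
Definition enorm (R : realType) (d : nat) (z : 'rV[R[i]]_d) : R :=
  Num.sqrt (\sum_(j < d) (complex.Re (z ord0 j) ^+ 2 + complex.Im (z ord0 j) ^+ 2)).

Definition uball (R : realType) (d : nat) : set 'rV[R[i]]_d :=
  [set z | enorm z < 1].

Definition cuball (R : realType) (d : nat) : set 'rV[R[i]]_d :=
  [set z | enorm z <= 1].

Definition usphere (R : realType) (d : nat) : set 'rV[R[i]]_d :=
  [set z | enorm z = 1].

Arguments uball {R} d.
Arguments cuball {R} d.
Arguments usphere {R} d.

(* Maps defined on a subset of C^d are represented by total functions whose
   values elsewhere are irrelevant.  [differentiable] is relative to the
   scalar field R[i], i.e. it is complex differentiability. *)
Definition holomorphic_on (R : realType) (m n : nat) (A : set 'rV[R[i]]_m)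
    (f : 'rV[R[i]]_m -> 'rV[R[i]]_n) : Prop :=
  forall z, A z -> differentiable f z.

Definition proper_map (S T : topologicalType) (A : set S) (B : set T)
    (f : S -> T) : Prop :=
  forall K : set T, K `<=` B -> compact K -> compact (A `&` f @^-1` K).

Definition hoelder_on (R : realType) (m n : nat) (alpha : R)
    (A : set 'rV[R[i]]_m) (f : 'rV[R[i]]_m -> 'rV[R[i]]_n) : Prop :=
  exists c : R, forall x y, A x -> A y ->
    enorm (f x - f y) <= c * enorm (x - y) `^ alpha.

Definition ball_inv (R : realType) (d : nat)
    (g : 'rV[R[i]]_d -> 'rV[R[i]]_d) : 'rV[R[i]]_d -> 'rV[R[i]]_d :=
  'pinv_(fun=> 0) (uball d) g.

Definition ball_aut (R : realType) (d : nat)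
    (g : 'rV[R[i]]_d -> 'rV[R[i]]_d) : Prop :=
  [/\ set_bij (uball d) (uball d) g,
      holomorphic_on (uball d) g &
      holomorphic_on (uball d) (ball_inv g)].

Definition symmetry_group (R : realType) (m n : nat)
    (f : 'rV[R[i]]_m -> 'rV[R[i]]_n) :
    set (('rV[R[i]]_m -> 'rV[R[i]]_m) * ('rV[R[i]]_n -> 'rV[R[i]]_n)) :=
  [set p | [/\ ball_aut p.1, ball_aut p.2 &
    forall z, uball m z -> f z = p.2 (f (ball_inv p.1 z))]].

(* The continuous extension of g from the ball to the closed ball. *)
Definition ball_ext (R : realType) (d : nat)
    (g : 'rV[R[i]]_d -> 'rV[R[i]]_d) (x : 'rV[R[i]]_d) : 'rV[R[i]]_d :=
  lim (g @ within (uball d) (nbhs x)).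

Definition bdry_fix (R : realType) (d : nat)
    (g : 'rV[R[i]]_d -> 'rV[R[i]]_d) : set 'rV[R[i]]_d :=
  [set x | usphere d x /\ ball_ext g x = x].

Definition loxodromic (R : realType) (d : nat)
    (g : 'rV[R[i]]_d -> 'rV[R[i]]_d) : Prop :=
  [/\ ball_aut g,
      ~ (exists2 z, uball d z & g z = z) &
      exists p q, p <> q /\ bdry_fix g = [set p; q]].

Definition complex_affine_line (R : realType) (d : nat)
    (L : set 'rV[R[i]]_d) : Prop :=
  exists a b : 'rV[R[i]]_d, b <> 0 /\ L = [set a + t *: b | t in [set: R[i]]].

(* The line L_g; it exists and is unique when g is loxodromic, and is an
   arbitrary set otherwise. *)
Definition axis (R : realType) (d : nat) (g : 'rV[R[i]]_d -> 'rV[R[i]]_d) :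
    set 'rV[R[i]]_d :=
  get [set L | complex_affine_line L /\ bdry_fix g `<=` L].

(* Main.v *)
Require Import Defs.
From HB Require Import structures.
From mathcomp Require Import all_boot all_order all_algebra.
From mathcomp Require Import all_classical all_reals topology normedtype derive.
From mathcomp Require Import exp.
From mathcomp Require Import complex.
From mathcomp Require Import sequences landau trigo.
From mathcomp Require Import measure lebesgue_measure lebesgue_integral ftc.
From mathcomp Require Import ring lra.

Import Order.TTheory GRing.Theory Num.Theory.
Import numFieldNormedType.Exports.
Local Open Scope classical_set_scope.
Local Open Scope ring_scope.

Set Implicit Arguments.
Unset Strict Implicit.
Unset Printing Implicit Defensive.

(** Points z of C^d are lifted to the vectors (z, 1) of C^d x C, which carries
  the Hermitian form h of signature (d, 1).  Every automorphism of the ball is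
  induced by a linear map preserving h ([ball_aut_lorentz]).  Hence it extends
  to the closed ball, a fixed point is an eigenvector, and the eigenvalues l, k
  at two distinct fixed boundary points satisfy l * conj k = 1 ([eigen_pair]).
  For phi loxodromic, |l| is not 1, since otherwise l = k and the midpoint of
  the two fixed points would be fixed ([multiplier_neq1]).  So one of them, p,
  is attracting, with |l| > 1, and the other one, q, is repelling.

  Let z be a point of the ball on the axis of phi, z_n its orbit, and
  d_n = 1 - |z_n|^2.  On the axis the orbit approaches p without tangency:
  |z_n - p| <= C d_n while d_n tends to 0 ([pencil_attracted],
  [pencil_to_boundary]).  The Schwarz lemma gives 1 - |f z|^2 >= c (1 - |z|^2)
  ([schwarz_boundary_estimate]) and the Hölder condition gives
  |f z_n - f p|^2 <= C d_n^(2 alpha).  As 2 alpha > 1, this yields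
      |f z_n - f p|^2 = o(1 - |f z_n|^2),
  and likewise at q for the backward orbit ([orbit_approaches]).  Everything
  follows from this estimate, applied to the orbit w_n = f z_n of w = f z
  under psi, whose lift is an isometry B of h fixing the lines of f p and f q.
  - The number |h((w, 1), (f p, 1))|^2 / (1 - |w|^2) is divided at each step by
    the squared modulus of the eigenvalue of B at f p, and it tends to 0 along
    the orbit: that eigenvalue has modulus greater than 1
    ([attracting_multiplier]).  The backward orbit shows that the eigenvalue at
    f q has modulus less than 1 ([repelling_multiplier]).  So f p and f q are
    distinct, psi has no fixed point in the ball and no third one on the sphere
    ([loxodromic_of_multiplier]).
  - Let V be the component of (w, 1) orthogonal to (f p, 1) and (f q, 1).  The
    ratio h(V, V) / (1 - |w|^2) is invariant under psi, and at w_n it is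
    bounded by a multiple of |w_n - f p|^2 / (1 - |w_n|^2), hence tends to 0.
    So V = 0, which says that w lies on the line through f p and f q
    ([axis_image_ball]).
  The points of the axis on the sphere are reached by continuity
  ([image_of_axis]).

  The analytic input is the Schwarz lemma for functions that are only assumed
  complex differentiable.  Goursat's theorem ([goursat]) in the coordinates
  (x, y) of a + exp (x + i y) shows, by periodicity in y, that the mean of Re k
  over circles around a does not depend on the radius; what is needed is that
  Re k almost exceeds its value at the centre somewhere on each circle
  ([circle_exceeds_center]).  The maximum principle for the quotient s(z) / z
  follows, and with it the Schwarz lemma ([schwarz_disc], [schwarz_ball]).  Its
  case of equality ([Re_nonneg_vanishing]) shows that an automorphism fixing 0
  is linear ([norm_preserving_linear]), and explicit involutions move any point
  of the ball to 0. *)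

(** * Goursat's theorem for differential forms on rectangles *)

(** Integrals enter only through primitives: a difference of values of a
  primitive is additive under subdivision and is estimated by the mean value
  theorem. *)
Lemma continuous_has_primitive (R : realType) (u : R -> R) (a : R) :
  continuous u ->
  exists F : R -> R, forall x, a < x -> is_derive x (1 : R) F (u x).
Proof.
move=> cu.
exists (fun x => \int[lebesgue_measure]_(t in `[a, x]) u t)%R => x ax.
have int_u : lebesgue_measure.-integrable `[a, x + 1] (EFin \o u).
  apply: continuous_compact_integrable; first exact: segment_compact.
  exact: continuous_subspaceT.
have x1 : x < x + 1 by rewrite ltrDl.
have [dF F'] := continuous_FTC1_closed x1 int_u ax (cu x).
by apply: DeriveDef; [exact: dF | rewrite -derive1E; exact: F'].
Qed.

(** When F u is a primitive of Q(u, .) and G v one of P(., v), this is the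
  integral of P dx + Q dy along the boundary of [a, a + s] x [b, b + t]. *)
Definition rect_form (R : realType) (F G : R -> R -> R) (a b s t : R) : R :=
  ((F (a + s) (b + t) - F (a + s) b) - (F a (b + t) - F a b))
  - ((G (b + t) (a + s) - G (b + t) a) - (G b (a + s) - G b a)).

Lemma is_derive_increment_bound (R : realType) (H h : R -> R) (a s M : R) :
  0 <= s -> (forall x, a <= x <= a + s -> is_derive x (1 : R) H (h x)) ->
  (forall x, a <= x <= a + s -> `|h x| <= M) ->
  `|H (a + s) - H a| <= M * s.
Proof.
move=> s0 dH hM; have aas : a <= a + s by rewrite lerDl.
have cH : {within `[a, a + s], continuous H}.
  apply: derivable_within_continuous => x; rewrite in_itv /= => xI.
  by apply: (@ex_derive _ _ _ _ _ _ _ (dH x xI)).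
have dH' x : x \in `]a, a + s[%R -> is_derive x 1 H (h x).
  by rewrite in_itv /= => /andP[ax xs]; apply: dH; rewrite !ltW.
have [c + ->] := MVT_segment aas dH' cH.
rewrite in_itv /= => cI.
by rewrite [a + s]addrC addrK normrM (ger0_norm s0) ler_wpM2r // hM.
Qed.

Lemma nested_intervals (R : realType) (s : R) (a : nat -> R) : 0 <= s ->
  (forall n, a n <= a n.+1 /\ a n.+1 + s / 2 ^+ n.+1 <= a n + s / 2 ^+ n) ->
  exists x, forall n, a n <= x <= a n + s / 2 ^+ n.
Proof.
move=> s0 an.
have amono n k : a n <= a (n + k)%N.
  elim: k => [|k IH]; first by rewrite addn0.
  by rewrite addnS; apply: le_trans IH _; case: (an (n + k)%N).
have bmono n k : a (n + k)%N + s / 2 ^+ (n + k) <= a n + s / 2 ^+ n.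
  elim: k => [|k IH]; first by rewrite addn0.
  by rewrite addnS; apply: le_trans IH; case: (an (n + k)%N).
have p0 n : 0 <= s / 2 ^+ n by rewrite divr_ge0 // exprn_ge0.
have ub n m : a m <= a n + s / 2 ^+ n.
  have [nm|/ltnW mn] := leqP n m.
    by have := bmono n (m - n)%N; rewrite subnKC // => /(le_trans _)-> //; rewrite lerDl.
  by have := amono m (n - m)%N; rewrite subnKC // => /le_trans-> //; rewrite lerDl.
have hs : has_sup (range a).
  split; first by exists (a 0), 0%N.
  by exists (a 0%N + s / 2 ^+ 0) => _ [m _ <-].
exists (sup (range a)) => n; apply/andP; split.
  by apply: ub_le_sup; [case: hs | exists n].
by apply: ge_sup; [case: hs | move=> _ [m _ <-]].
Qed.

(** If P and Q are affine up to e times the distance to (x, y), with equal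
  mixed coefficients c, the affine parts cancel because their form is closed,
  and only the errors remain: they are of order e l on sides of length at most
  l. *)
Lemma rect_form_small (R : realType) (P Q F G : R -> R -> R) (a b s t l : R)
    (x y cx c cy e : R) :
  0 <= e -> 0 <= s <= l -> 0 <= t <= l ->
  a <= x <= a + s -> b <= y <= b + t ->
  (forall u v, a <= u <= a + s -> b <= v <= b + t ->
     [/\ is_derive v (1 : R) (F u) (Q u v), is_derive u (1 : R) (G v) (P u v),
         `|P u v - P x y - (cx * (u - x) + c * (v - y))| <=
            e * (`|u - x| + `|v - y|) &
         `|Q u v - Q x y - (c * (u - x) + cy * (v - y))| <=
            e * (`|u - x| + `|v - y|)]) ->
  `|rect_form F G a b s t| <= 8 * e * l ^+ 2.
Proof.
move=> e0 /andP[s0 sl] /andP[t0 tl] xI yI FG.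
have dist u v : a <= u <= a + s -> b <= v <= b + t ->
    e * (`|u - x| + `|v - y|) <= e * (2 * l).
  move=> uI vI; apply: ler_wpM2l => //.
  have : `|u - x| <= l by apply/ler_normlP; split; lra.
  have : `|v - y| <= l by apply/ler_normlP; split; lra.
  by lra.
have aI : a <= a <= a + s by lra.
have asI : a <= a + s <= a + s by lra.
have bI : b <= b <= b + t by lra.
have btI : b <= b + t <= b + t by lra.
pose H v := F (a + s) v - F a v - c * s * v.
pose K u := G (b + t) u - G b u - c * t * u.
have HB : `|H (b + t) - H b| <= 4 * e * l * t.
  apply: (@is_derive_increment_bound _ H
    (fun v => Q (a + s) v - Q a v - c * s)) => // v vI.
    have [d1 _ _ _] := FG _ _ asI vI; have [d2 _ _ _] := FG _ _ aI vI.
    by apply: is_derive_eq; rewrite /GRing.scale /= mulr1.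
  have [_ _ _ q1] := FG _ _ asI vI; have [_ _ _ q2] := FG _ _ aI vI.
  have := dist _ _ asI vI; have := dist _ _ aI vI.
  move: q1 q2 => /ler_normlP[? ?] /ler_normlP[? ?] ? ?.
  by apply/ler_normlP; split; lra.
have KB : `|K (a + s) - K a| <= 4 * e * l * s.
  apply: (@is_derive_increment_bound _ K
    (fun u => P u (b + t) - P u b - c * t)) => // u uI.
    have [_ d1 _ _] := FG _ _ uI btI; have [_ d2 _ _] := FG _ _ uI bI.
    by apply: is_derive_eq; rewrite /GRing.scale /= mulr1.
  have [_ _ q1 _] := FG _ _ uI btI; have [_ _ q2 _] := FG _ _ uI bI.
  have := dist _ _ uI btI; have := dist _ _ uI bI.
  move: q1 q2 => /ler_normlP[? ?] /ler_normlP[? ?] ? ?.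
  by apply/ler_normlP; split; lra.
have -> : rect_form F G a b s t = (H (b + t) - H b) - (K (a + s) - K a).
  by rewrite /rect_form /H /K; ring.
apply: le_trans (ler_normB _ _) _; apply: le_trans (lerD HB KB) _.
have el : 0 <= e * l by rewrite mulr_ge0 // (le_trans s0).
have : e * l * t <= e * l * l by apply: ler_wpM2l.
have : e * l * s <= e * l * l by apply: ler_wpM2l.
by rewrite expr2; lra.
Qed.

(** The boundary integral is the sum of those over the four quarters, so one
  quarter carries at least a quarter of it. *)
Lemma rect_form_quarter (R : realType) (F G : R -> R -> R) (a b s t th : R) :
  th <= `|rect_form F G a b s t| ->
  exists i j : bool,
    th / 4 <= `|rect_form F G (a + i%:R * (s / 2)) (b + j%:R * (t / 2)) (s / 2) (t / 2)|.
Proof.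
move=> thI; pose J (i j : bool) :=
  rect_form F G (a + i%:R * (s / 2)) (b + j%:R * (t / 2)) (s / 2) (t / 2).
have IE : rect_form F G a b s t =
    J false false + J true false + J false true + J true true.
  have sE : s = s / 2 + s / 2 by lra.
  have tE : t = t / 2 + t / 2 by lra.
  rewrite /J /rect_form !mul0r !addr0 !mul1r [in LHS]sE [in LHS]tE !addrA.
  ring.
apply: contrapT => nJ.
have lt i j : `|J i j| < th / 4.
  by rewrite ltNge; apply/negP => ?; apply: nJ; exists i, j.
have := lt false false; have := lt true false; have := lt false true.
have := lt true true; rewrite IE in thI => h1 h2 h3 h4.
have := le_trans thI (ler_normD _ _).
have := ler_normD (J false false + J true false) (J false true).
have := ler_normD (J false false) (J true false).
by lra.
Qed.

Definition in_rect (R : realType) (a b s t x y : R) :=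
  a <= x <= a + s /\ b <= y <= b + t.

(** Goursat's bisection.  If the integral were nonzero, nested quarters would
  carry at least th / 4^n, but at their common point [rect_form_small] gives e
  l^2 / 4^n with e as small as desired.  No continuity of the derivatives is
  used. *)
Lemma goursat (R : realType) (P Q F G : R -> R -> R) (a b s t : R) :
  0 <= s -> 0 <= t ->
  (forall u v, in_rect a b s t u v ->
     is_derive v (1 : R) (F u) (Q u v) /\ is_derive u (1 : R) (G v) (P u v)) ->
  (forall x y, in_rect a b s t x y -> exists cx c cy, forall e, 0 < e ->
     exists2 d, 0 < d & forall u v, in_rect a b s t u v ->
       `|u - x| <= d -> `|v - y| <= d ->
       `|P u v - P x y - (cx * (u - x) + c * (v - y))| <=
            e * (`|u - x| + `|v - y|) /\
       `|Q u v - Q x y - (c * (u - x) + cy * (v - y))| <=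
            e * (`|u - x| + `|v - y|)) ->
  rect_form F G a b s t = 0.
Proof.
move=> s0 t0 prim jet; apply/eqP; apply: contrapT => /negP I0.
pose th := `|rect_form F G a b s t|.
have th0 : 0 < th by rewrite normr_gt0.
pose inv n (p : R * R) :=
  th / 4 ^+ n <= `|rect_form F G p.1 p.2 (s / 2 ^+ n) (t / 2 ^+ n)|.
have s2 n : s / 2 ^+ n.+1 = s / 2 ^+ n / 2 by rewrite exprSr invfM mulrA.
have t2 n : t / 2 ^+ n.+1 = t / 2 ^+ n / 2 by rewrite exprSr invfM mulrA.
have th4 n : th / 4 ^+ n.+1 = th / 4 ^+ n / 4 by rewrite exprSr invfM mulrA.
have sn n : 0 <= s / 2 ^+ n by rewrite divr_ge0 // exprn_ge0.
have tn n : 0 <= t / 2 ^+ n by rewrite divr_ge0 // exprn_ge0.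
have stepP (np : nat * (R * R)) : exists p' : R * R, inv np.1 np.2 ->
    [/\ inv np.1.+1 p',
      np.2.1 <= p'.1 /\ p'.1 + s / 2 ^+ np.1.+1 <= np.2.1 + s / 2 ^+ np.1 &
      np.2.2 <= p'.2 /\ p'.2 + t / 2 ^+ np.1.+1 <= np.2.2 + t / 2 ^+ np.1].
  case: np => n p /=; have [invp|] := pselect (inv n p); last by exists p.
  have [i [j ij]] := rect_form_quarter invp.
  exists (p.1 + i%:R * (s / 2 ^+ n / 2), p.2 + j%:R * (t / 2 ^+ n / 2)) => _.
  split=> /=; rewrite ?s2 ?t2.
  - by rewrite /inv /= s2 t2 th4.
  - by have := sn n; case: (i) => /= ?; split; lra.
  - by have := tn n; case: (j) => /= ?; split; lra.
have [step stepE] := choice stepP.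
pose p := fix p n := if n is m.+1 then step (m, p m) else (a, b).
have invp n : inv n (p n).
  elim: n => [|n IH]; first by rewrite /inv /= expr0 !divr1.
  by have [] := stepE (n, p n) IH.
have [x xP] : exists x, forall n, (p n).1 <= x <= (p n).1 + s / 2 ^+ n.
  by apply: nested_intervals => // n; have [] := stepE (n, p n) (invp n).
have [y yP] : exists y, forall n, (p n).2 <= y <= (p n).2 + t / 2 ^+ n.
  by apply: nested_intervals => // n; have [] := stepE (n, p n) (invp n).
have sub n : [/\ a <= (p n).1, (p n).1 + s / 2 ^+ n <= a + s,
                 b <= (p n).2 & (p n).2 + t / 2 ^+ n <= b + t].
  elim: n => [|n [h1 h2 h3 h4]]; first by rewrite /= expr0 !divr1.
  have [_ [h5 h6] [h7 h8]] := stepE (n, p n) (invp n).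
  by split; rewrite /= in h5 h6 h7 h8 *; lra.
have xyI : in_rect a b s t x y.
  by have := xP 0%N; have := yP 0%N; rewrite /= expr0 !divr1.
have [cx [c [cy jetxy]]] := jet x y xyI.
pose l := s + t + 1.
have l0 : 0 < l by rewrite /l; lra.
(* so that the bound 8 e l^2 of [rect_form_small] is th / 2 *)
pose e := th / (16 * l ^+ 2).
have e0 : 0 < e by rewrite divr_gt0 // mulr_gt0 // exprn_gt0.
have [d d0 dP] := jetxy e e0.
have [n nP] : exists n, l / 2 ^+ n <= d.
  exists (Num.bound (l / d)); rewrite ler_pdivrMr ?exprn_gt0 //.
  rewrite mulrC -ler_pdivrMr // ltW //; apply: lt_le_trans (archi_boundP _) _.
    by rewrite divr_ge0 // ltW.
  by rewrite -natrX ler_nat ltnW // ltn_expl.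
have ln : 0 <= s / 2 ^+ n <= l / 2 ^+ n.
  by rewrite sn ler_pM2r ?invr_gt0 ?exprn_gt0 //= /l; lra.
have lt : 0 <= t / 2 ^+ n <= l / 2 ^+ n.
  by rewrite tn ler_pM2r ?invr_gt0 ?exprn_gt0 //= /l; lra.
have := rect_form_small (ltW e0) ln lt (xP n) (yP n).
move=> /(_ P Q F G cx c cy) small.
have : `|rect_form F G (p n).1 (p n).2 (s / 2 ^+ n) (t / 2 ^+ n)|
    <= 8 * e * (l / 2 ^+ n) ^+ 2.
  apply: small => u v uI vI; have [h1 h2 h3 h4] := sub n.
  have uvI : in_rect a b s t u v by split; lra.
  have [d1 d2] := prim u v uvI.
  have := xP n; have := yP n => yn xn.
  have ud : `|u - x| <= d by apply/ler_normlP; split; lra.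
  have vd : `|v - y| <= d by apply/ler_normlP; split; lra.
  by have [] := dP u v uvI ud vd.
move=> /(le_trans (invp n)).
have -> : 8 * e * (l / 2 ^+ n) ^+ 2 = th / 4 ^+ n / 2.
  rewrite /e exprMn exprVn -exprM mulnC exprM.
  have -> : (2 : R) ^+ 2 = 4 by ring.
  by field; rewrite !expf_neq0 // ?gt_eqF.
have : 0 < th / 4 ^+ n by rewrite divr_gt0 // exprn_gt0.
by lra.
Qed.

(** * Complex differentiability in polar coordinates *)

Notation cabs := ComplexField.Normc.normc.

Lemma normr_cabs (R : realType) (z : R[i]) : `|z| = (cabs z)%:C%C.
Proof. by case: z. Qed.

Lemma cabs_ge0 (R : realType) (z : R[i]) : 0 <= cabs z.
Proof. by case: z => a b /=; rewrite sqrtr_ge0. Qed.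

Lemma Re_le_cabs (R : realType) (z : R[i]) : `|complex.Re z| <= cabs z.
Proof. by have := normc_ge_Re z; rewrite normr_cabs lecR. Qed.

Lemma Im_le_cabs (R : realType) (z : R[i]) : `|complex.Im z| <= cabs z.
Proof.
case: z => a b /=; rewrite -(@ger0_norm _ (Num.sqrt _)) ?sqrtr_ge0 //.
rewrite -ler_sqr ?nnegrE // !real_normK ?num_real // sqr_sqrtr; last first.
  by rewrite addr_ge0 ?sqr_ge0.
by rewrite lerDr sqr_ge0.
Qed.

Lemma cabs_le_ReIm (R : realType) (z : R[i]) :
  cabs z <= `|complex.Re z| + `|complex.Im z|.
Proof.
rewrite -ler_sqr ?nnegrE ?cabs_ge0 ?addr_ge0 //.
case: z => a b /=; rewrite sqr_sqrtr ?addr_ge0 ?sqr_ge0 //.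
rewrite sqrrD !real_normK ?num_real //.
have : 0 <= `|a| * `|b| by rewrite mulr_ge0.
by lra.
Qed.

Lemma complex_pos (R : realType) (e : R[i]) :
  0 < e -> exists2 r : R, 0 < r & e = r%:C%C.
Proof.
case: e => a b; rewrite ltcE /= => /andP[/eqP -> a0]; by exists a.
Qed.

Lemma differentiable_jet (K : numFieldType) (V W : normedModType K)
    (f : V -> W) (x : V) (e : K) : differentiable f x -> 0 < e ->
  exists2 d : K, 0 < d &
    forall h, `|h| < d -> `|f (h + x) - f x - 'd f x h| <= e * `|h|.
Proof.
move=> /diff_locally /eqaddoP /(_ e) o e0.
have /nbhs_norm0P[d /= d0 dP] := o e0.
exists d => // h hd; have := dP h hd.
by rewrite /= opprD addrA.
Qed.

(** The derivative as an estimate with real constants, which is the form used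
  with [goursat]. *)
Lemma complex_jet (R : realType) (k : R[i] -> R[i]) (z : R[i]) :
  differentiable k z -> exists l : R[i], forall e : R, 0 < e ->
  exists2 d : R, 0 < d & forall w, cabs (w - z) < d ->
    cabs (k w - k z - l * (w - z)) <= e * cabs (w - z).
Proof.
move=> dk; exists ('d k z 1) => e e0.
have [d d0 dP] := @differentiable_jet _ _ _ k z e%:C%C dk ltac:(by rewrite ltcR).
have [r r0 dE] := complex_pos d0.
exists r => // w wz.
have := dP (w - z); rewrite dE !normr_cabs ltcR => /(_ wz).
rewrite subrK -rmorphM lecR.
have -> : 'd k z (w - z) = 'd k z ((w - z) *: (1 : R[i])).
  by rewrite /GRing.scale /= mulr1.
by rewrite linearZ /= [_ *: _]mulrC.
Qed.

Lemma complex_continuous (R : realType) (k : R[i] -> R[i]) (z : R[i]) :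
  {for z, continuous k} -> forall e : R, 0 < e ->
  exists2 d : R, 0 < d & forall w, cabs (w - z) < d -> cabs (k w - k z) < e.
Proof.
move=> /cvgrPdist_lt ck e e0.
have /(_ _) := ck e%:C%C; rewrite ltcR => /(_ e0) /nbhs_normP [d /= d0 dP].
have [r r0 dE] := complex_pos d0.
exists r => // w wz.
have := dP w; rewrite /= distrC dE !normr_cabs ltcR => /(_ wz).
by rewrite ltcR -normcN opprB.
Qed.

Definition cexp (R : realType) (x y : R) : R[i] :=
  Complex (expR x * cos y) (expR x * sin y).

Lemma cexpD (R : realType) (x y u v : R) :
  cexp (x + u) (y + v) = cexp x y * cexp u v.
Proof.
rewrite /cexp expRD cosD sinD; apply/eqP; rewrite eq_complex /=.
by apply/andP; split; apply/eqP; ring.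
Qed.

Lemma cabs_cexp (R : realType) (x y : R) : cabs (cexp x y) = expR x.
Proof.
rewrite /cexp /= !exprMn -mulrDr cos2Dsin2 mulr1 sqrtr_sqr ger0_norm //.
exact: expR_ge0.
Qed.

Lemma real_jet0 (R : realType) (f : R -> R) (df e : R) :
  is_derive (0 : R) (1 : R) f df -> 0 < e -> exists2 d : R, 0 < d &
    forall h, `|h| < d -> `|f h - f 0 - df * h| <= e * `|h|.
Proof.
move=> df0 e0.
have dif : differentiable f 0 by apply/derivable1_diffP; exact: ex_derive.
have [d d0 dP] := differentiable_jet dif e0.
exists d => // h hd; have := dP h hd.
by rewrite addr0 diff1E // derive1E derive_val /GRing.scale /= mulrC.
Qed.

Lemma cexp_jet (R : realType) (e : R) : 0 < e -> exists2 d : R, 0 < d &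
  forall u v, `|u| < d -> `|v| < d ->
    cabs (cexp u v - 1 - Complex u v) <= e * (`|u| + `|v|).
Proof.
move=> e0.
(* the errors estimated below add up to at most 6 e1 (|u| + |v|) *)
pose e1 := Num.min (e / 6) 1.
have e10 : 0 < e1 by rewrite lt_min ltr01 andbT; lra.
have e11 : e1 <= 1 by rewrite ge_min lexx orbT.
have e1e : e1 <= e / 6 by rewrite ge_min lexx.
have [d1 d10 exp_jet] := real_jet0 (is_derive_expR 0) e10.
have [d2 d20 cos_jet] := real_jet0 (is_derive_cos 0) e10.
have [d3 d30 sin_jet] := real_jet0 (is_derive_sin 0) e10.
pose d := Num.min (Num.min d1 d2) (Num.min d3 (e1 / 2)).
exists d; first by rewrite !lt_min d10 d20 d30 divr_gt0.
move=> u v; rewrite !lt_min => /andP[/andP[u1 u2] /andP[u3 u4]].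
move=> /andP[/andP[v1 v2] /andP[v3 v4]].
have := exp_jet u u1; have := cos_jet v v2; have := sin_jet v v3.
rewrite expR0 cos0 sin0 oppr0 mul0r !subr0 ?addr0 !mul1r.
set S := sin v - v; set C := cos v - 1; set X := expR u - 1 - u => hS hC hX.
have e1u : e1 * `|u| <= `|u| by rewrite ler_piMl.
have hXX : `|expR u - 1| <= 2 * `|u|.
  have -> : expR u - 1 = X + u by rewrite /X; ring.
  by apply: le_trans (ler_normD _ _) _; lra.
have hX1 : `|expR u - 1| <= e1 by lra.
have hE : `|expR u| <= 2.
  have -> : expR u = (expR u - 1) + 1 by ring.
  by apply: le_trans (ler_normD _ _) _; rewrite normr1; lra.
have p1 : `|expR u * C| <= 2 * (e1 * `|v|) by rewrite normrM ler_pM.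
have p2 : `|expR u * S| <= 2 * (e1 * `|v|) by rewrite normrM ler_pM.
have p3 : `|(expR u - 1) * v| <= e1 * `|v| by rewrite normrM ler_pM.
have eu : e1 * `|u| <= e / 6 * `|u| by rewrite ler_wpM2r.
have ev : e1 * `|v| <= e / 6 * `|v| by rewrite ler_wpM2r.
have eu0 : 0 <= e * `|u| by rewrite mulr_ge0 // ltW.
have ev0 : 0 <= e * `|v| by rewrite mulr_ge0 // ltW.
apply: le_trans (cabs_le_ReIm _) _; rewrite /cexp /= !subr0.
have -> : expR u * cos v - 1 - u = expR u * C + X by rewrite /C /X; ring.
have -> : expR u * sin v - v = expR u * S + (expR u - 1) * v.
  by rewrite /S; ring.
apply: le_trans (lerD (ler_normD _ _) (ler_normD _ _)) _.
clear -p1 p2 p3 eu ev eu0 ev0 hX; lra.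
Qed.

(** The chain rule for a + exp (x + i y).  The linear part l * (u - x + i (v -
  y)) is complex linear, which is the Cauchy-Riemann relation between the real
  and imaginary parts. *)
Lemma polar_jet (R : realType) (k : R[i] -> R[i]) (a : R[i]) (x y : R) :
  differentiable k (a + cexp x y) ->
  exists l : R[i], forall e : R, 0 < e -> exists2 d : R, 0 < d &
    forall u v, `|u - x| < d -> `|v - y| < d ->
    cabs (k (a + cexp u v) - k (a + cexp x y) - l * Complex (u - x) (v - y))
      <= e * (`|u - x| + `|v - y|).
Proof.
move=> /complex_jet[l lP]; exists (l * cexp x y) => e e0.
pose r := expR x; have r0 : 0 < r by exact: expR_gt0.
pose e2 := Num.min 1 (e / (2 * (cabs l * r + 1))).
have lr : 0 <= cabs l * r by rewrite mulr_ge0 ?cabs_ge0 // ltW.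
have e20 : 0 < e2 by rewrite lt_min ltr01 divr_gt0 //; lra.
have e21 : e2 <= 1 by rewrite ge_min lexx.
have e2e : e2 * (cabs l * r) <= e / 2.
  have h : e2 <= e / (2 * (cabs l * r + 1)) by rewrite ge_min lexx orbT.
  have p0 : 0 < 2 * (cabs l * r + 1) by lra.
  by move: h; rewrite ler_pdivlMr // => h; lra.
have [d1 d10 d1P] := lP (e / (4 * r)) ltac:(by rewrite divr_gt0 // mulr_gt0).
have [d2 d20 d2P] := cexp_jet e20.
pose d := Num.min d2 (d1 / (4 * r)).
have q0 : 0 < 4 * r by rewrite mulr_gt0.
exists d; first by rewrite lt_min d20 divr_gt0.
move=> u v; rewrite !lt_min => /andP[u2 u1] /andP[v2 v1].
set D := Complex (u - x) (v - y).
set N := `|u - x| + `|v - y|.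
have ND : cabs D <= N by exact: cabs_le_ReIm.
have N0 : 0 <= N by rewrite addr_ge0.
have E2 := d2P _ _ u2 v2.
set c := cexp (u - x) (v - y) in E2.
have cE : cexp u v = cexp x y * c by rewrite -cexpD !subrKC.
have c1 : cabs (c - 1) <= 2 * N.
  have -> : c - 1 = (c - 1 - D) + D by rewrite subrK.
  apply: le_trans (le_normcD _ _) _; rewrite -/D -/N in E2.
  have : e2 * N <= N by rewrite ler_piMl.
  by lra.
have wE : a + cexp u v - (a + cexp x y) = cexp x y * (c - 1).
  by rewrite cE; ring.
have wN : cabs (cexp x y * (c - 1)) <= r * (2 * N).
  by rewrite ComplexField.Normc.normcM cabs_cexp ler_wpM2l // ltW.
have Nd : r * (2 * N) < d1.
  move: u1 v1; rewrite !ltr_pdivlMr // => u1 v1.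
  have -> : r * (2 * N) = (`|u - x| * (4 * r) + `|v - y| * (4 * r)) / 2.
    by rewrite /N; field.
  by lra.
have := d1P (a + cexp u v); rewrite wE => /(_ (le_lt_trans wN Nd)) E1.
have -> : k (a + cexp u v) - k (a + cexp x y) - l * cexp x y * D =
  (k (a + cexp u v) - k (a + cexp x y) - l * (cexp x y * (c - 1)))
  + l * cexp x y * (c - 1 - D) by ring.
apply: le_trans (le_normcD _ _) _.
have h1 : e / (4 * r) * cabs (cexp x y * (c - 1)) <= e / 2 * N.
  apply: le_trans (ler_wpM2l _ wN) _; first by rewrite divr_ge0 // ltW.
  by rewrite le_eqVlt; apply/orP; left; apply/eqP; field; rewrite gt_eqF.
have h2 : cabs (l * cexp x y * (c - 1 - D)) <= e / 2 * N.
  rewrite !ComplexField.Normc.normcM cabs_cexp -/r.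
  apply: le_trans (ler_wpM2l lr E2) _.
  by rewrite mulrA ler_wpM2r // mulrC.
by have := lerD (le_trans E1 h1) h2; lra.
Qed.

(** * Mean values over circles *)

Lemma min_continuous (R : realType) (c : R) :
  continuous (fun x : R => Num.min x c).
Proof.
move=> x; apply/cvgrPdist_le => e e0; near=> y.
have : `|x - y| <= e by near: y; exact: cvgr_dist_le.
move=> /ler_normlP[h1 h2]; apply/ler_normlP.
by rewrite /Num.min; case: ltP => ?; case: ltP => ?; split; lra.
Unshelve. all: by end_near. Qed.

Lemma polar_partial (R : realType) (k : R[i] -> R[i]) (a : R[i]) (x y : R) :
  differentiable k (a + cexp x y) ->
  {for y, continuous (fun v => complex.Re (k (a + cexp x v)))} /\
  {for x, continuous (fun u => complex.Im (k (a + cexp u y)))}.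
Proof.
move=> /polar_jet[l lP].
have main e : 0 < e -> exists2 d : R, 0 < d & forall u v,
    `|u - x| < d -> `|v - y| < d ->
    cabs (k (a + cexp u v) - k (a + cexp x y)) <= e.
  move=> e0; have [d d0 dP] := lP 1 ltr01.
  pose K := cabs l + 1; have K0 : 0 < K by rewrite ltr_wpDl ?cabs_ge0.
  exists (Num.min d (e / (2 * K))).
    by rewrite lt_min d0 divr_gt0 // mulr_gt0.
  move=> u v; rewrite !lt_min !ltr_pdivlMr ?mulr_gt0 //.
  move=> /andP[u1 u2] /andP[v1 v2]; have := dP u v u1 v1.
  set D := Complex _ _; set w := _ - _ - _ => wN.
  have -> : k (a + cexp u v) - k (a + cexp x y) = w + l * D.
    by rewrite /w; ring.
  apply: le_trans (le_normcD _ _) _; rewrite ComplexField.Normc.normcM.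
  have : cabs l * cabs D <= cabs l * (`|u - x| + `|v - y|).
    by rewrite ler_wpM2l ?cabs_ge0 //; exact: cabs_le_ReIm.
  by rewrite /K in u2 v2 *; lra.
split; apply/cvgrPdist_le => e e0; have [d d0 dP] := main e e0; near=> t.
- rewrite distrC -raddfB; apply: le_trans (Re_le_cabs _) _.
  apply: dP; first by rewrite subrr normr0.
  by rewrite distrC; near: t; exact: cvgr_dist_lt.
- rewrite distrC -raddfB; apply: le_trans (Im_le_cabs _) _.
  apply: dP; last by rewrite subrr normr0.
  by rewrite distrC; near: t; exact: cvgr_dist_lt.
Unshelve. all: by end_near. Qed.

(** The form Im k dx + Re k dy is closed in polar coordinates, and its
  integrals over the horizontal sides y = 0 and y = 2 pi cancel by
  periodicity.  So the integrals of Re k over the two circles agree, and the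
  mean value theorem turns each of them into a value of Re k. *)
Lemma circle_values_meet (R : realType) (k : R[i] -> R[i]) (a : R[i]) (x0 x1 : R) :
  x0 <= x1 ->
  (forall x y, x <= x1 -> differentiable k (a + cexp x y)) ->
  exists y0 y1, complex.Re (k (a + cexp x0 y0)) = complex.Re (k (a + cexp x1 y1)).
Proof.
move=> x01 dk.
pose Q x y := complex.Re (k (a + cexp x y)).
pose P x y := complex.Im (k (a + cexp x y)).
have /choice[F FP] x : exists F : R -> R, x <= x1 -> forall y : R, -1 < y ->
    is_derive y (1 : R) F (Q x y).
  have [xx1|_] := leP x x1; last by exists id.
  have [|F dF] := @continuous_has_primitive _ (Q x) (-1); last by exists F.
  by move=> y; have [] := polar_partial (dk x y xx1).
(* P is only defined for x <= x1; it is continued to the right by its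
   value there, so that the primitive is differentiable at x1 too *)
have /choice[G GP] y : exists G : R -> R, forall x, x0 - 1 < x -> x <= x1 ->
    is_derive x (1 : R) G (P x y).
  have [|G dG] := @continuous_has_primitive _ (fun x => P (Num.min x x1) y) (x0 - 1).
    move=> x; apply: (@continuous_comp _ _ _ (fun x => Num.min x x1) (P ^~ y)).
      exact: min_continuous.
    have xx1 : Num.min x x1 <= x1 by rewrite ge_min lexx orbT.
    by have [] := polar_partial (dk (Num.min x x1) y xx1).
  by exists G => x hx xx1; have := dG x hx; rewrite min_l.
pose T : R := pi *+ 2; have T0 : 0 < T by rewrite pmulrn_lgt0 // pi_gt0.
have s0 : 0 <= x1 - x0 by rewrite subr_ge0.
have I0 : rect_form F G x0 0 (x1 - x0) T = 0.
  apply: (@goursat _ P Q) => //; first exact: ltW.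
    move=> u v [uI vI]; split.
      by apply: FP; clear -uI vI; lra.
    by apply: GP; clear -uI vI; lra.
  move=> x y [xI yI]; have xx1 : x <= x1 by clear -xI; lra.
  have [l lP] := polar_jet (dk x y xx1).
  exists (complex.Im l), (complex.Re l), (- complex.Im l) => e e0.
  have [d d0 dP] := lP e e0; exists (d / 2); first by rewrite divr_gt0.
  have d2 : d / 2 < d by clear -d0; lra.
  move=> u v _ ud vd; have := dP u v (le_lt_trans ud d2) (le_lt_trans vd d2).
  set w := _ - _ - _ => wN.
  split.
    have := le_trans (Im_le_cabs w) wN.
    by rewrite /w !raddfB; case: (l) => l1 l2 /=; rewrite [l1 * _ + _]addrC.
  have := le_trans (Re_le_cabs w) wN.
  by rewrite /w !raddfB; case: (l) => l1 l2 /=; rewrite mulNr.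
have per x : cexp x T = cexp x 0.
  by rewrite /cexp /T cos2pi sin2pi cos0 sin0.
have GE : (G T x1 - G T x0) - (G 0 x1 - G 0 x0) = 0.
  pose H u := G T u - G 0 u.
  have dH u : x0 <= u <= x0 + (x1 - x0) -> is_derive u (1 : R) H (P u T - P u 0).
    move=> uI; have u0 : x0 - 1 < u by clear -uI; lra.
    have u1 : u <= x1 by clear -uI; lra.
    by have d1 := GP T u u0 u1; have d2 := GP 0 u u0 u1; apply: is_deriveB.
  have bH u : x0 <= u <= x0 + (x1 - x0) -> `|P u T - P u 0| <= 0.
    by move=> _; rewrite /P per subrr normr0.
  have := is_derive_increment_bound s0 dH bH.
  rewrite subrKC mul0r normr_le0 /H => /eqP E; rewrite -[RHS]E; ring.
have FE x : x <= x1 -> exists y, F x T - F x 0 = Q x y * T.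
  move=> xx1.
  have cF : {within `[0, T], continuous (F x)}.
    apply: derivable_within_continuous => y; rewrite in_itv /= => yI.
    apply: ex_derive; apply: FP => //; by clear -yI; lra.
  have dF y : y \in `]0, T[%R -> is_derive y 1 (F x) (Q x y).
    by rewrite in_itv /= => yI; apply: FP => //; clear -yI; lra.
  have [y _ ->] := MVT T0 dF cF; exists y; by rewrite subr0.
have [y0 F0] := FE x0 x01; have [y1 F1] := FE x1 (lexx _).
exists y0, y1; apply: (mulIf (lt0r_neq0 T0)).
rewrite -/(Q x0 y0) -/(Q x1 y1) -F0 -F1.
move: I0; rewrite /rect_form add0r subrKC GE subr0 => /eqP.
by rewrite subr_eq0 => /eqP.
Qed.

(** In the coordinate exp (x + i y) the centre is never reached, so only the
  limit c of k at a matters; this covers removable singularities.  The inner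
  circle of [circle_values_meet] is taken so small that Re k is close to Re c
  on it. *)
Lemma circle_exceeds_center (R : realType) (k : R[i] -> R[i]) (a c : R[i]) (r e : R) :
  0 < r -> 0 < e ->
  (forall e : R, 0 < e -> exists2 d : R, 0 < d &
     forall z, 0 < cabs (z - a) < d -> cabs (k z - c) < e) ->
  (forall z, 0 < cabs (z - a) <= r -> differentiable k z) ->
  exists2 z, cabs (z - a) = r & complex.Re c <= complex.Re (k z) + e.
Proof.
move=> r0 e0 ka dk.
have [d d0 dP] := ka e e0.
pose x1 := ln r; have x1E : expR x1 = r by rewrite lnK.
pose x0 := Num.min x1 (ln (d / 2)).
have x01 : x0 <= x1 by rewrite ge_min lexx.
have x0d : expR x0 < d.
  apply: (@le_lt_trans _ _ (expR (ln (d / 2)))).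
    by rewrite ler_expR ge_min lexx orbT.
  by rewrite lnK ?posrE ?divr_gt0 //; lra.
have [|y0 [y1 E]] := @circle_values_meet _ k a x0 x1 x01.
  move=> x y xx1; apply: dk; rewrite [a + _]addrC addrK cabs_cexp expR_gt0 /=.
  by rewrite -x1E ler_expR.
exists (a + cexp x1 y1); first by rewrite [a + _]addrC addrK cabs_cexp.
rewrite -E.
have := dP (a + cexp x0 y0).
rewrite [a + _]addrC addrK cabs_cexp expR_gt0 => /(_ x0d).
move=> /ltW /(le_trans (Re_le_cabs _)) /ler_normlP[+ _].
by rewrite raddfB /=; lra.
Qed.

(** * The Schwarz lemma on the unit disc *)

Lemma cabs_sqr (R : realType) (z : R[i]) :
  cabs z ^+ 2 = complex.Re z ^+ 2 + complex.Im z ^+ 2.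
Proof. by case: z => a b /=; rewrite sqr_sqrtr // addr_ge0 ?sqr_ge0. Qed.

Lemma cabs_eq0 (R : realType) (z : R[i]) : (cabs z == 0) = (z == 0).
Proof.
apply/eqP/eqP => [/ComplexField.Normc.eq0_normc //|->].
exact: ComplexField.Normc.normc0.
Qed.

Lemma cabs_gt0 (R : realType) (z : R[i]) : (0 < cabs z) = (z != 0).
Proof. by rewrite lt_def cabs_ge0 andbT cabs_eq0. Qed.

Lemma cabsM (R : realType) (z w : R[i]) : cabs (z * w) = cabs z * cabs w.
Proof. exact: ComplexField.Normc.normcM. Qed.

Lemma cabsV (R : realType) (z : R[i]) : cabs z^-1 = (cabs z)^-1.
Proof. exact: ComplexField.Normc.normcV. Qed.

Lemma cabsB (R : realType) (z w : R[i]) : cabs (z - w) = cabs (w - z).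
Proof. by rewrite -normcN opprB. Qed.

Lemma cabs_dist (R : realType) (z w : R[i]) : `|cabs z - cabs w| <= cabs (z - w).
Proof.
have h1 : cabs z <= cabs (z - w) + cabs w by rewrite -{1}(subrK w z) le_normcD.
have h2 : cabs w <= cabs (w - z) + cabs z by rewrite -{1}(subrK z w) le_normcD.
by rewrite cabsB in h2; apply/ler_normlP; split; lra.
Qed.

Lemma cabs_real (R : realType) (r : R) : cabs r%:C%C = `|r|.
Proof. by rewrite /= expr0n addr0 sqrtr_sqr. Qed.

Lemma cabs0 (R : realType) : cabs (0 : R[i]) = 0.
Proof. exact: ComplexField.Normc.normc0. Qed.

Arguments ComplexField.Normc.normc {R} x : simpl never.

(** The topology of the complex numbers comes from a norm with complex values;
  this and the next lemma give continuity from real epsilons. *)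
Lemma continuous_complexP (R : realType) (V : normedModType R) (f : R[i] -> V) (z : R[i]) :
  (forall e : R, 0 < e -> exists2 d : R, 0 < d &
     forall w, cabs (w - z) < d -> `|f w - f z| < e) ->
  {for z, continuous f}.
Proof.
move=> fz; apply/(@cvgrPdist_lt _ _ _ (nbhs z) _ f (f z)) => e e0; have [d d0 dP] := fz e e0.
apply/nbhs_normP; exists d%:C%C; rewrite /= ?ltcR // => w /=.
by rewrite distrC normr_cabs ltcR distrC; exact: dP.
Qed.

Lemma continuous_complex_selfP (R : realType) (f : R[i] -> R[i]) (z : R[i]) :
  (forall e : R, 0 < e -> exists2 d : R, 0 < d &
     forall w, cabs (w - z) < d -> cabs (f w - f z) < e) ->
  {for z, continuous f}.
Proof.
move=> fz; apply/(@cvgrPdist_lt _ _ _ (nbhs z) _ f (f z)) => _ /complex_pos[e e0 ->].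
have [d d0 dP] := fz e e0.
apply/nbhs_normP; exists d%:C%C; rewrite /= ?ltcR // => w /=.
by rewrite distrC !normr_cabs !ltcR [cabs (f z - _)]cabsB; exact: dP.
Qed.

(** The closed disc is closed in the image of a square under (x, y) |-> x + i
  y. *)
Lemma compact_disc (R : realType) (r : R) : compact [set z : R[i] | cabs z <= r].
Proof.
pose mk (p : R * R) : R[i] := Complex p.1 p.2.
have mk_cont : continuous mk.
  move=> [x y]; apply/cvgrPdist_lt => e /complex_pos[t t0 ->].
  have t2 : 0 < t / 2 by rewrite divr_gt0.
  exists (ball x (t / 2), ball y (t / 2)).
    by split; apply: nbhsx_ballx.
  move=> [u v] [/= h1 h2].
  rewrite normr_cabs ltcR; apply: le_lt_trans (cabs_le_ReIm _) _ => /=.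
  by move: h1 h2; rewrite /ball /=; lra.
have sq : compact (mk @` (`[- r, r] `*` `[- r, r])).
  apply: continuous_compact; first exact: continuous_subspaceT.
  by apply: compact_setX; exact: segment_compact.
apply: subclosed_compact sq _; last first.
  move=> z /= zr; exists (complex.Re z, complex.Im z); last by case: (z).
  have /ler_normlP[? ?] := le_trans (Re_le_cabs z) zr.
  have /ler_normlP[? ?] := le_trans (Im_le_cabs z) zr.
  by split => /=; rewrite in_itv /=; lra.
apply: (@preimage_closed _ _ (fun z : R[i] => cabs z) [set x | x <= r]); last exact: closed_le.
move=> z _; apply: continuous_complexP => e e0; exists e => // w.
exact: le_lt_trans (cabs_dist _ _).
Qed.

Lemma disc_max (R : realType) (f : R[i] -> R) (r : R) : 0 <= r ->
  (forall z, cabs z <= r -> {for z, continuous f}) ->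
  exists2 a, cabs a <= r & forall z, cabs z <= r -> f z <= f a.
Proof.
move=> r0 fc.
have [|||a aI aP] := @compact_EVT_max _ _ f [set z | cabs z <= r].
- by exists 0; rewrite /= cabs0.
- exact: compact_disc.
- by apply: continuous_in_subspaceT => z; rewrite inE; exact: fc.
exists a; first by rewrite inE in aI.
by move=> z zr; apply: aP; rewrite inE.
Qed.

Lemma Re_mul_conj (R : realType) (z w : R[i]) :
  2 * complex.Re (z * w^*%C) = cabs z ^+ 2 + cabs w ^+ 2 - cabs (z - w) ^+ 2.
Proof. by rewrite !cabs_sqr; case: z w => a b [c d] /=; ring. Qed.

Lemma continuous_sqr_comb (R : realType) (T : topologicalType) (f g : T -> R) (e : R) (w : T) :
  {for w, continuous f} -> {for w, continuous g} ->
  {for w, continuous (fun z => f z ^+ 2 + e * g z ^+ 2)}.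
Proof.
move=> fc gc.
apply: (@cvgD _ _ _ (nbhs w) _ (fun z => f z ^+ 2) (fun z => e * g z ^+ 2)).
  exact: (cvgM fc fc).
apply: (@cvgM _ _ (nbhs w) _ (fun=> e) (fun z => g z ^+ 2)); first exact: cvg_cst.
exact: (cvgM gc gc).
Qed.

Lemma continuous_lin_comb (R : realType) (h : R[i] -> R[i]) (p q w : R[i]) :
  {for w, continuous h} -> {for w, continuous (fun z => p * h z + q * z)}.
Proof.
move=> hc.
apply: (@cvgD _ _ _ (nbhs w) _ (fun z => p * h z) (fun z => q * z)).
  by apply: (@cvgM _ _ (nbhs w) _ (fun=> p) h); [exact: cvg_cst|exact: hc].
apply: (@cvgM _ _ (nbhs w) _ (fun=> q) id); first exact: cvg_cst.
exact: cvg_id.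
Qed.

Lemma differentiable_lin_comb (R : realType) (g : R[i] -> R[i]) (p q w : R[i]) :
  differentiable g w -> differentiable (fun z => p * g z + q * z) w.
Proof.
move=> dg.
apply: (@differentiableD _ _ _ (fun w => p * g w) (fun w => q * w)).
  by apply: (@differentiableM _ _ (fun=> p) g); [exact: differentiable_cst|exact: dg].
apply: (@differentiableM _ _ (fun=> q) id); first exact: differentiable_cst.
exact: ex_diff.
Qed.

Section Schwarz.
Variables (R : realType) (s : R[i] -> R[i]).
Hypothesis s_diff : forall z, cabs z < 1 -> differentiable s z.
Hypothesis s_le1 : forall z, cabs z < 1 -> cabs (s z) <= 1.
Hypothesis s0 : s 0 = 0.

(** The quotient s(z) / z, continued at 0 by the derivative of s. *)
Lemma schwarz_quotient : exists2 h : R[i] -> R[i],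
  (forall z, z != 0 -> h z = s z / z) &
  forall z, cabs z < 1 -> {for z, continuous h}.
Proof.
have [|l lP] := @complex_jet _ s 0; first by apply: s_diff; rewrite cabs0.
pose h z := if z == 0 then l else s z / z.
exists h => [z /negPf z0|z z1]; first by rewrite /h z0.
have [->|z0] := eqVneq z 0.
  apply: continuous_complex_selfP => e e0.
  have e2 : 0 < e / 2 by rewrite divr_gt0.
  have [d d0 dP] := lP _ e2.
  exists d => // w; rewrite {2}/h eqxx subr0 => wd.
  rewrite /h; case: eqVneq => [_|w0]; first by rewrite subrr cabs0.
  have := dP w; rewrite s0 !subr0 => /(_ wd) sw.
  have cw : 0 < cabs w by rewrite cabs_gt0.
  have -> : s w / w - l = (s w - l * w) / w by field.
  rewrite cabsM cabsV ltr_pdivrMr //; apply: le_lt_trans sw _.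
  by rewrite ltr_pM2r //; lra.
have dq : differentiable (fun w => s w * w^-1) z.
  exact: (differentiableM (s_diff z1) (differentiable_Rinv z0)).
apply: continuous_complex_selfP => e e0.
have [d d0 dP] := complex_continuous (differentiable_continuous dq) e0.
exists (Num.min d (cabs z)); first by rewrite lt_min d0 cabs_gt0.
move=> w; rewrite lt_min => /andP[wd wz].
have w0 : w != 0 by apply: contraTneq wz => ->; rewrite sub0r normcN ltxx.
by rewrite /h (negPf z0) (negPf w0); exact: dP.
Qed.

(** Maximum principle for h(z) = s(z) / z on the disc of radius r < 1, in a
  form that only needs a weak mean value inequality.  The term e |z|^2 makes
  |h|^2 + e |z|^2 strictly subharmonic: were its maximum attained at an
  interior point a, the function 2 conj(h(a)) h(z) + 2 e conj(a) z would stay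
  below its value at a on small circles by a fixed amount e rho^2, against
  [circle_exceeds_center].  So the maximum is on the circle of radius r, where
  |h| <= 1 / r; then r tends to 1 and e to 0. *)
Lemma schwarz_disc z : cabs z < 1 -> cabs (s z) <= cabs z.
Proof.
have [h hE hc] := schwarz_quotient.
move=> z1; have [->|z0] := eqVneq z 0; first by rewrite s0.
have key r e : 0 < e -> cabs z <= r -> r < 1 ->
    cabs (s z) ^+ 2 * r ^+ 2 <= cabs z ^+ 2 * (1 + e).
  move=> e0 zr r1; have cz : 0 < cabs z by rewrite cabs_gt0.
  have r0 : 0 < r by exact: lt_le_trans zr.
  pose Phi w := cabs (h w) ^+ 2 + e * cabs w ^+ 2.
  have cont_cabs w : {for w, continuous (fun z : R[i] => cabs z)}.
    by apply: continuous_complexP => t t0; exists t => // v; exact: le_lt_trans (cabs_dist _ _).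
  have Phi_cont w : cabs w <= r -> {for w, continuous Phi}.
    move=> wr; have w1 := le_lt_trans wr r1.
    have c1 : {for w, continuous (fun z => cabs (h z))}.
      by apply: (@continuous_comp _ _ _ h (fun z : R[i] => cabs z)); [exact: hc | exact: cont_cabs].
    exact: continuous_sqr_comb c1 (cont_cabs w).
  have [a ar aP] := disc_max (ltW r0) Phi_cont.
  have aE : cabs a = r.
    apply/eqP; rewrite eq_le ar /= leNgt; apply/negP => alt.
    (* the circle around a must avoid 0 unless a is its centre *)
    pose rho := if a == 0 then r else Num.min (cabs a / 2) (r - cabs a).
    have rho0 : 0 < rho.
      rewrite /rho; case: eqVneq => // a0.
      by rewrite lt_min subr_gt0 alt divr_gt0 // cabs_gt0.
    have rhor : cabs a + rho <= r.
      rewrite /rho; case: eqVneq => [->|a0]; first by rewrite cabs0 add0r.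
      by rewrite -lerBrDl ge_min lexx orbT.
    have away w : 0 < cabs (w - a) <= rho -> w != 0.
      move=> /andP[w0]; rewrite /rho; case: eqVneq => [aE|a0].
        by rewrite aE subr0 cabs_gt0 in w0.
      rewrite le_min => /andP[+ _]; apply: contraTneq => ->.
      by rewrite sub0r normcN -ltNge ltr_pdivrMr // ltr_pMr ?ltr1n // cabs_gt0.
    have near_r w : cabs (w - a) <= rho -> cabs w <= r.
      move=> wa; apply: le_trans rhor; have -> : w = a + (w - a) by ring.
      by apply: le_trans (le_normcD _ _) _; rewrite lerD2l.
    pose q : R[i] := (e%:C%C).
    pose k w := (2 * (h a)^*%C) * (s w * w^-1) + (2 * q * a^*%C) * w.
    pose c := (2 * (h a)^*%C) * h a + (2 * q * a^*%C) * a.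
    have ReE (x u y v : R[i]) :
        complex.Re ((2 * u^*%C) * x + (2 * q * v^*%C) * y) =
        2 * complex.Re (x * u^*%C) + e * (2 * complex.Re (y * v^*%C)).
      by case: x u y v => x1 x2 [u1 u2] [y1 y2] [v1 v2] /=; ring.
    have k_lim t : 0 < t -> exists2 d : R, 0 < d &
        forall w, 0 < cabs (w - a) < d -> cabs (k w - c) < t.
      move=> t0; pose g w := (2 * (h a)^*%C) * h w + (2 * q * a^*%C) * w.
      have gc : {for a, continuous g}.
        by apply: continuous_lin_comb; apply: hc; exact: le_lt_trans r1.
      have [d d0 dP] := complex_continuous gc t0.
      exists (Num.min d rho); first by rewrite lt_min d0.
      move=> w; rewrite lt_min => /andP[wa /andP[wd wrho]].
      have w0 : w != 0 by apply: away; rewrite wa /=; exact: ltW.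
      have -> : k w = g w by rewrite /k /g (hE w w0).
      exact: dP.
    have k_diff w : 0 < cabs (w - a) <= rho -> differentiable k w.
      move=> wI; have w0 := away w wI; have /andP[_ wrho] := wI.
      have w1 : cabs w < 1 by exact: le_lt_trans (near_r w wrho) r1.
      apply: differentiable_lin_comb.
      exact: (differentiableM (s_diff w1) (differentiable_Rinv w0)).
    have t0 : 0 < e * rho ^+ 2 / 2 by rewrite divr_gt0 // mulr_gt0 // exprn_gt0.
    have [w wrho] := circle_exceeds_center rho0 t0 k_lim k_diff.
    have w0 : w != 0 by apply: away; rewrite wrho rho0 lexx.
    have Phiw := aP w (near_r w ltac:(by rewrite wrho)).
    have erho : 0 < e * rho ^+ 2 by rewrite mulr_gt0 // exprn_gt0.
    rewrite /k -hE // /c !ReE !Re_mul_conj !subrr cabs0 wrho.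
    have := sqr_ge0 (cabs (h w - h a)).
    by rewrite /Phi in Phiw; lra.
  have := aP z zr; rewrite /Phi !hE //; last by rewrite -cabs_gt0 aE.
  rewrite !cabsM !cabsV aE.
  have sa : cabs (s a) <= 1 by apply: s_le1; rewrite aE.
  have sa2 : cabs (s a) ^+ 2 <= 1 by rewrite expr_le1 // cabs_ge0.
  have ez : 0 <= e * cabs z ^+ 2 by rewrite mulr_ge0 ?exprn_ge0 ?cabs_ge0 // ltW.
  have r2 : 0 < r ^+ 2 by rewrite exprn_gt0.
  have z2 : 0 < cabs z ^+ 2 by rewrite exprn_gt0.
  have rle1 : r ^+ 2 <= 1 by rewrite expr_le1 // ltW.
  move=> H; have : cabs (s z) ^+ 2 / cabs z ^+ 2 <= 1 / r ^+ 2 + e * r ^+ 2.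
    rewrite !exprMn !exprVn in H.
    have : cabs (s a) ^+ 2 / r ^+ 2 <= 1 / r ^+ 2 by rewrite ler_pM2r ?invr_gt0.
    by lra.
  rewrite ler_pdivrMr // => H2.
  have {H2}H2 := ler_wpM2r (ltW r2) H2.
  apply: le_trans H2 _.
  have -> : (1 / r ^+ 2 + e * r ^+ 2) * cabs z ^+ 2 * r ^+ 2 =
     cabs z ^+ 2 * (1 + e * (r ^+ 2) ^+ 2) by field; rewrite gt_eqF.
  rewrite ler_pM2l // lerD2l ler_piMr ?(ltW e0) // expr_le1 // ltW //.
rewrite -ler_sqr ?nnegrE ?cabs_ge0 //; apply/ler_addgt0Pr => e e0.
pose t := Num.min (e / 4) (1 - cabs z).
have t0 : 0 < t by rewrite lt_min divr_gt0 // subr_gt0.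
have te : t <= e / 4 by rewrite ge_min lexx.
have tz : t <= 1 - cabs z by rewrite ge_min lexx orbT.
have := key (1 - t) (e / 2) ltac:(by rewrite divr_gt0) ltac:(by lra) ltac:(by lra).
have sz2 : cabs (s z) ^+ 2 <= 1 by rewrite expr_le1 ?cabs_ge0 // s_le1.
have cz2 : cabs z ^+ 2 <= 1 by rewrite expr_le1 ?cabs_ge0 // ltW.
have sz0 : 0 <= cabs (s z) ^+ 2 by rewrite sqr_ge0.
have : cabs (s z) ^+ 2 * t <= t by rewrite ler_piMl // ltW.
have : 0 <= cabs (s z) ^+ 2 * t ^+ 2 by rewrite mulr_ge0 // sqr_ge0.
have : cabs z ^+ 2 * (e / 2) <= e / 2 by rewrite ler_piMl // ltW // divr_gt0.
by lra.
Qed.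

End Schwarz.

(** The strong maximum principle, from the Schwarz lemma by scaling: N k / (N
  k + 2) maps the disc to itself and vanishes at 0 for every N, so N |k(z)| (1
  - |z|) <= 2. *)
Lemma Re_nonneg_vanishing (R : realType) (k : R[i] -> R[i]) :
  (forall z, cabs z < 1 -> differentiable k z) ->
  (forall z, cabs z < 1 -> 0 <= complex.Re (k z)) -> k 0 = 0 ->
  forall z, cabs z < 1 -> k z = 0.
Proof.
move=> kd k_ge0 k0.
have den_le (n : nat) w : cabs w < 1 -> cabs (n%:R * k w) <= cabs (n%:R * k w + 2).
  move=> /k_ge0 kw; rewrite -ler_sqr ?nnegrE ?cabs_ge0 // !cabs_sqr.
  have nkw : 0 <= complex.Re (n%:R * k w).
    rewrite -(rmorph_nat (real_complex R)).
    by case: (k w) kw => a b /= a0; rewrite mul0r subr0 mulr_ge0.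
  by case: (n%:R * k w) nkw => a b /= a0; lra.
have den_neq0 (n : nat) w : cabs w < 1 -> n%:R * k w + 2 != 0.
  move=> w1; apply/eqP => E; have := den_le n w w1; rewrite E cabs0.
  move: E => /eqP; rewrite addr_eq0 => /eqP ->; rewrite normcN -[2]/(2%:R).
  by rewrite -(rmorph_nat (real_complex R)) cabs_real normr_nat; lra.
have bound (n : nat) z : cabs z < 1 -> cabs (k z) * (1 - cabs z) * n%:R <= 2.
  move=> z1; pose s w := n%:R * k w * (n%:R * k w + 2)^-1.
  have kn w : cabs w < 1 -> differentiable (fun w => n%:R * k w) w.
    move=> w1; apply: (@differentiableM _ _ (fun=> n%:R) k); last exact: kd.
    exact: differentiable_cst.
  have sd w : cabs w < 1 -> differentiable s w.
    move=> w1; apply: (@differentiableM _ _ (fun w => n%:R * k w)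
      (fun w => (n%:R * k w + 2)^-1)); first exact: kn.
    apply: (@differentiableV _ _ (fun w => n%:R * k w + 2)); last exact: den_neq0.
    apply: (@differentiableD _ _ _ (fun w => n%:R * k w) (fun=> 2)); first exact: kn.
    exact: differentiable_cst.
  have s1 w : cabs w < 1 -> cabs (s w) <= 1.
    move=> w1; rewrite /s cabsM cabsV ler_pdivrMr ?cabs_gt0 ?den_neq0 // mul1r.
    exact: den_le.
  have s0 : s 0 = 0 by rewrite /s k0 mulr0 mul0r.
  have := schwarz_disc sd s1 s0 z1.
  rewrite /s cabsM cabsV ler_pdivrMr ?cabs_gt0 ?den_neq0 // => H.
  have c2 : cabs (2 : R[i]) = 2.
    by rewrite -[2]/(2%:R) -(rmorph_nat (real_complex R)) cabs_real normr_nat.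
  have cn : cabs (n%:R * k z) = n%:R * cabs (k z).
    by rewrite cabsM -(rmorph_nat (real_complex R)) cabs_real normr_nat.
  have : cabs z * cabs (n%:R * k z + 2) <= cabs z * (n%:R * cabs (k z) + 2).
    rewrite ler_wpM2l ?cabs_ge0 //; apply: le_trans (le_normcD _ _) _.
    by rewrite cn c2.
  have : cabs z * 2 <= 2 by rewrite ler_piMl // ltW.
  by rewrite cn in H; lra.
move=> z z1; apply/eqP; rewrite -cabs_eq0 eq_le cabs_ge0 andbT leNgt.
apply/negP => kz; pose c := cabs (k z) * (1 - cabs z).
have c0 : 0 < c by rewrite mulr_gt0 // subr_gt0.
have := archi_boundP (divr_ge0 (ler0n _ 2) (ltW c0)).
by rewrite ltr_pdivrMr // mulrC ltNge (bound _ z z1).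
Qed.

(** * Hermitian geometry of C^d *)

Definition dot (R : realType) (d : nat) (z w : 'rV[R[i]]_d) : R[i] :=
  \sum_(j < d) z ord0 j * (w ord0 j)^*%C.

Section Dot.
Variables (R : realType) (d : nat).
Implicit Types (x y z w : 'rV[R[i]]_d) (a : R[i]).

Lemma dotDl x y w : dot (x + y) w = dot x w + dot y w.
Proof. by rewrite /dot -big_split; apply: eq_bigr => j _; rewrite mxE mulrDl. Qed.

Lemma dotZl a x w : dot (a *: x) w = a * dot x w.
Proof. by rewrite /dot mulr_sumr; apply: eq_bigr => j _; rewrite mxE mulrA. Qed.

Lemma dotJ x y : (dot x y)^*%C = dot y x.
Proof.
rewrite /dot rmorph_sum; apply: eq_bigr => j _.
by rewrite rmorphM /= conjcK mulrC.
Qed.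

Lemma dotDr w x y : dot w (x + y) = dot w x + dot w y.
Proof. by rewrite -dotJ dotDl rmorphD /= !dotJ. Qed.

Lemma dotZr a w x : dot w (a *: x) = a^*%C * dot w x.
Proof. by rewrite -dotJ dotZl rmorphM /= dotJ. Qed.

Lemma dotNl x w : dot (- x) w = - dot x w.
Proof. by rewrite -scaleN1r dotZl mulN1r. Qed.

Lemma dotNr w x : dot w (- x) = - dot w x.
Proof. by rewrite -dotJ dotNl rmorphN /= dotJ. Qed.

Lemma dotBl x y w : dot (x - y) w = dot x w - dot y w.
Proof. by rewrite dotDl dotNl. Qed.

Lemma dotBr w x y : dot w (x - y) = dot w x - dot w y.
Proof. by rewrite dotDr dotNr. Qed.

Lemma dot0l w : dot 0 w = 0.
Proof. by rewrite -(scale0r (0 : 'rV_d)) dotZl mul0r. Qed.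

Lemma dot0r w : dot w 0 = 0.
Proof. by rewrite -dotJ dot0l conjc0. Qed.

Lemma enorm_ge0 x : 0 <= enorm x. Proof. exact: sqrtr_ge0. Qed.

Lemma dotxx x : dot x x = (enorm x ^+ 2)%:C%C.
Proof.
rewrite /enorm sqr_sqrtr; last by apply: sumr_ge0 => j _; rewrite addr_ge0 ?sqr_ge0.
rewrite rmorph_sum; apply: eq_bigr => j _.
by case: (x ord0 j) => a b; apply/eqP; rewrite eq_complex /=; apply/andP; split; apply/eqP; ring.
Qed.

Lemma enorm0 : enorm (0 : 'rV[R[i]]_d) = 0.
Proof.
have := dotxx 0; rewrite dot0l => /eqP; rewrite eq_sym -(rmorph0 (real_complex R)).
by move=> /eqP /complexI /eqP; rewrite sqrf_eq0 => /eqP.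
Qed.

Lemma enorm_coord x j : cabs (x ord0 j) <= enorm x.
Proof.
rewrite -ler_sqr ?nnegrE ?cabs_ge0 ?enorm_ge0 // /enorm sqr_sqrtr.
  by rewrite cabs_sqr (bigD1 j) //= lerDl sumr_ge0 // => i _; rewrite addr_ge0 ?sqr_ge0.
by apply: sumr_ge0 => i _; rewrite addr_ge0 ?sqr_ge0.
Qed.

Lemma enorm_eq0 x : (enorm x == 0) = (x == 0).
Proof.
apply/eqP/eqP => [x0|->]; last exact: enorm0.
apply/rowP => j; apply/eqP; rewrite mxE -cabs_eq0 eq_le cabs_ge0 andbT -x0.
exact: enorm_coord.
Qed.

Lemma enormZ a x : enorm (a *: x) = cabs a * enorm x.
Proof.
apply/eqP; rewrite -(@eqrXn2 _ 2) ?enorm_ge0 ?mulr_ge0 ?cabs_ge0 ?enorm_ge0 //.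
apply/eqP/complexI; rewrite -dotxx dotZl dotZr dotxx mulrA -sqr_normc normr_cabs.
by rewrite -rmorphXn -rmorphM exprMn.
Qed.

Lemma enormN x : enorm (- x) = enorm x.
Proof. by rewrite -scaleN1r enormZ normcN ComplexField.Normc.normc1 mul1r. Qed.

Lemma enormB x y : enorm (x - y) = enorm (y - x).
Proof. by rewrite -enormN opprB. Qed.

Lemma dot_sqr_le x y : cabs (dot x y) ^+ 2 <= enorm x ^+ 2 * enorm y ^+ 2.
Proof.
have [->|y0] := eqVneq y 0.
  by rewrite dot0r cabs0 expr0n /= mulr_ge0 // sqr_ge0.
have ny : 0 < enorm y ^+ 2 by rewrite exprn_gt0 // lt_def enorm_eq0 y0 enorm_ge0.
have dxy : dot x y * dot y x = (cabs (dot x y) ^+ 2)%:C%C.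
  by rewrite -(dotJ x y) -sqr_normc normr_cabs rmorphXn.
have := dotxx x; have := dotxx y; move: dxy ny.
move: (enorm x ^+ 2) (enorm y ^+ 2) (cabs _ ^+ 2) => X Y Q dxy Y0 hY hX.
pose v := dot y y *: x - dot x y *: y.
have : dot v v = (Y * (Y * X - Q))%:C%C.
  rewrite /v dotBl !dotBr !dotZl !dotZr !dotJ rmorphM rmorphB rmorphM /= -hX -hY -dxy.
  by ring.
rewrite dotxx => /complexI E.
have : 0 <= Y * (Y * X - Q) by rewrite -E sqr_ge0.
by rewrite pmulr_rge0 // subr_ge0 mulrC.
Qed.

Lemma dot_le x y : cabs (dot x y) <= enorm x * enorm y.
Proof.
rewrite -ler_sqr ?nnegrE ?mulr_ge0 ?cabs_ge0 ?enorm_ge0 //.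
by rewrite exprMn dot_sqr_le.
Qed.

Lemma enorm_sqrD x y :
  enorm (x + y) ^+ 2 = enorm x ^+ 2 + 2 * complex.Re (dot x y) + enorm y ^+ 2.
Proof.
apply: complexI; rewrite -dotxx dotDl !dotDr -(dotJ x y) !rmorphD /= -!dotxx.
have -> : (2 * complex.Re (dot x y))%:C%C = dot x y + (dot x y)^*%C.
  by rewrite addcJ rmorphM rmorph_nat.
by ring.
Qed.

Lemma enormD x y : enorm (x + y) <= enorm x + enorm y.
Proof.
rewrite -ler_sqr ?nnegrE ?addr_ge0 ?enorm_ge0 // enorm_sqrD sqrrD.
have := le_trans (ler_norm _) (le_trans (Re_le_cabs _) (dot_le x y)).
by lra.
Qed.

Lemma enormBD x y : enorm (x - y) <= enorm x + enorm y.
Proof. by rewrite -(enormN y); exact: enormD. Qed.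

Lemma enorm_le_sum x : enorm x <= \sum_j cabs (x ord0 j).
Proof.
have s0 : 0 <= \sum_j cabs (x ord0 j) by apply: sumr_ge0 => j _; exact: cabs_ge0.
rewrite -ler_sqr ?nnegrE ?enorm_ge0 // /enorm sqr_sqrtr; last first.
  by apply: sumr_ge0 => i _; rewrite addr_ge0 ?sqr_ge0.
rewrite expr2 mulr_suml; apply: ler_sum => j _.
rewrite -cabs_sqr expr2 ler_wpM2l ?cabs_ge0 // (bigD1 j) //= lerDl.
by apply: sumr_ge0 => i _; exact: cabs_ge0.
Qed.

Lemma norm_le_enorm x : `|x| <= (enorm x)%:C%C.
Proof.
have [->|x0] := eqVneq x 0; first by rewrite normr0 ler0c enorm_ge0.
have nx : mx_norm x != 0 by apply: contra x0 => /eqP /mx_norm_eq0 ->.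
have [[i j] /= E] := mx_norm_neq0 nx.
rewrite -[`|x|]/(mx_norm x) E normr_cabs lecR ord1; exact: enorm_coord.
Qed.

Lemma enorm_lt_norm x (r : R) : `|x| < r%:C%C -> enorm x <= d%:R * r.
Proof.
move=> xr; apply: le_trans (enorm_le_sum x) _.
rewrite mulr_natl -[X in r *+ X]card_ord -sumr_const; apply: ler_sum => j _.
have : ball (0 : 'rV[R[i]]_d) r%:C%C x by rewrite -ball_normE /= sub0r normrN.
move=> [_ /(_ ord0 j)]; rewrite -ball_normE /= mxE sub0r normrN normr_cabs ltcR.
exact: ltW.
Qed.

Lemma nbhs_enormP x (P : set 'rV[R[i]]_d) :
  nbhs x P <-> exists2 r : R, 0 < r & forall y, enorm (y - x) < r -> P y.
Proof.
split.
  move=> /nbhs_normP[_ /= /complex_pos[r r0 ->] rP]; exists r => // y yr.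
  apply: rP; rewrite /= distrC; apply: le_lt_trans (norm_le_enorm _) _.
  by rewrite ltcR.
move=> [r r0 rP]; apply: (iffRL (@nbhs_normP _ _ x P)).
have s0 : 0 < r / d.+1%:R by rewrite divr_gt0.
exists (r / d.+1%:R)%:C%C; rewrite /= ?ltcR // => y; rewrite /= distrC.
move=> /enorm_lt_norm yr; apply: rP; apply: le_lt_trans yr _.
by rewrite mulrCA -[ltRHS]mulr1 ltr_pM2l // ltr_pdivrMr // mul1r ltr_nat.
Qed.

End Dot.

Lemma cvg_enormP (R : realType) (T : Type) (d : nat) (F : set_system T)
    (FF : Filter F) (f : T -> 'rV[R[i]]_d) (l : 'rV[R[i]]_d) :
  (forall e : R, 0 < e -> \forall t \near F, enorm (f t - l) < e) -> f @ F --> l.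
Proof.
move=> fl P /nbhs_enormP[r r0 rP]; have := fl r r0.
by apply: filterS => t /rP.
Qed.

Lemma compact_cuball (R : realType) (d : nat) (r : R) :
  compact [set z : 'rV[R[i]]_d | enorm z <= r].
Proof.
have cube : compact [set z : 'rV[R[i]]_d | forall j, [set w | cabs w <= r] (z ord0 j)].
  by apply: (@rV_compact _ _ (fun=> [set w | cabs w <= r])) => j; exact: compact_disc.
apply: (subclosed_compact _ cube); last first.
  by move=> z /= zr j; apply: le_trans zr; exact: enorm_coord.
move=> z zcl; rewrite /= leNgt; apply/negP => rz.
have [|w [wr wz]] := zcl [set w | enorm (w - z) < enorm z - r].
  by apply/nbhs_enormP; exists (enorm z - r) => //; rewrite subr_gt0.
have : enorm z <= enorm w + enorm (w - z).
  by have := enormBD w (w - z); rewrite subKr.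
by rewrite /= in wr wz; lra.
Qed.

Lemma differentiable_dotl (R : realType) (V : normedModType R[i]) (d : nat)
    (g : V -> 'rV[R[i]]_d) (x : V) (w : 'rV[R[i]]_d) :
  differentiable g x -> differentiable (fun y => dot (g y) w) x.
Proof.
move=> dg.
have -> : (fun y => dot (g y) w) =
    \sum_(j < d) (fun y => g y ord0 j * (w ord0 j)^*%C).
  by apply/funext => y; rewrite fct_sumE.
apply: differentiable_sum => j.
apply: (@differentiableM _ _ (fun y => g y ord0 j) (fun=> (w ord0 j)^*%C)).
  exact: differentiable_comp dg (differentiable_coord _ _ _).
exact: differentiable_cst.
Qed.

(** A map to C^d is a sum of scalar functions times basis vectors. *)
Lemma differentiable_rV (R : realType) (V : normedModType R[i]) (d : nat)
    (g : V -> 'rV[R[i]]_d) (x : V) :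
  (forall j, differentiable (fun y => g y ord0 j) x) -> differentiable g x.
Proof.
move=> dg.
have -> : g = \sum_(j < d) (fun y => g y ord0 j *: delta_mx ord0 j).
  by apply/funext => y; rewrite fct_sumE {1}[g y]row_sum_delta.
by apply: differentiable_sum => j; apply: differentiableZl.
Qed.

Lemma differentiable_slice (R : realType) (m : nat) (W : normedModType R[i])
    (g : 'rV[R[i]]_m -> W) (u : 'rV[R[i]]_m) (l : R[i]) :
  differentiable g (l *: u) -> differentiable (fun t : R[i] => g (t *: u)) l.
Proof.
move=> dg; apply: (@differentiable_comp _ _ _ _ (fun t : R[i] => t *: u) g) => //.
Qed.

(** * The Schwarz lemma for maps between balls *)

(** The scalar lemma applied on the complex line of z, paired with the
  direction of g(z). *)
Lemma schwarz_ball (R : realType) (m n : nat) (g : 'rV[R[i]]_m -> 'rV[R[i]]_n) :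
  holomorphic_on (uball m) g ->
  (forall z, uball m z -> enorm (g z) <= 1) -> g 0 = 0 ->
  forall z, uball m z -> enorm (g z) <= enorm z.
Proof.
move=> gd g1 g0 z z1.
have [->|z0] := eqVneq z 0; first by rewrite g0 !enorm0.
have [->|gz0] := eqVneq (g z) 0; first by rewrite enorm0 enorm_ge0.
have nz : 0 < enorm z by rewrite lt_def enorm_eq0 z0 enorm_ge0.
have ngz : 0 < enorm (g z) by rewrite lt_def enorm_eq0 gz0 enorm_ge0.
pose u := ((enorm z)^-1)%:C%C *: z; pose v := ((enorm (g z))^-1)%:C%C *: g z.
have u1 : enorm u = 1 by rewrite enormZ cabs_real gtr0_norm ?invr_gt0 // mulVf ?gt_eqF.
have v1 : enorm v = 1 by rewrite enormZ cabs_real gtr0_norm ?invr_gt0 // mulVf ?gt_eqF.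
pose s (l : R[i]) := dot (g (l *: u)) v.
have lu l : cabs l < 1 -> uball m (l *: u) by rewrite /uball /= enormZ u1 mulr1.
have sd l : cabs l < 1 -> differentiable s l.
  by move=> /lu l1; apply: differentiable_dotl; apply: differentiable_slice; exact: gd.
have s1 l : cabs l < 1 -> cabs (s l) <= 1.
  move=> /lu /g1 l1; apply: le_trans (dot_le _ _) _.
  by rewrite v1 mulr1.
have s0 : s 0 = 0 by rewrite /s scale0r g0 dot0l.
have := @schwarz_disc _ s sd s1 s0 (enorm z)%:C%C.
rewrite cabs_real gtr0_norm // => /(_ z1).
have -> : s (enorm z)%:C%C = (enorm (g z))%:C%C.
  rewrite /s scalerA -rmorphM mulfV ?gt_eqF // rmorph1 scale1r /v dotZr dotxx.
  rewrite conjc_real -rmorphM expr2 mulrA mulVf ?gt_eqF // mul1r //.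
by rewrite cabs_real gtr0_norm.
Qed.

(** On the line of the unit vector u, h(l) = g(l u) / l is a holomorphic map
  to the unit sphere, hence constant: 1 - <h, c> has nonnegative real part and
  vanishes at l = 1/2, where h = c.  The disc |l - 1/2| < 1/2 avoids l = 0 and
  contains the segment (0, 1). *)
Lemma norm_preserving_ray (R : realType) (m n : nat) (g : 'rV[R[i]]_m -> 'rV[R[i]]_n)
    (u : 'rV[R[i]]_m) :
  holomorphic_on (uball m) g -> (forall z, uball m z -> enorm (g z) = enorm z) ->
  enorm u = 1 -> exists c, forall t : R, 0 < t < 1 -> g (t%:C%C *: u) = t%:C%C *: c.
Proof.
move=> gd gn u1; pose c := 2 *: g ((2^-1 : R[i]) *: u); exists c.
have c2 : (2 : R[i]) = (2 : R)%:C%C by rewrite rmorph_nat.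
have half : cabs (2^-1 : R[i]) = 2^-1.
  by rewrite c2 -fmorphV cabs_real gtr0_norm // invr_gt0.
have hu : uball m ((2^-1 : R[i]) *: u).
  by rewrite /uball /= enormZ u1 half; lra.
have c1 : enorm c = 1.
  rewrite /c enormZ gn // enormZ u1 half c2 cabs_real gtr0_norm //; lra.
pose l (mu : R[i]) := 2^-1 * mu + 2^-1.
have l_lt1 mu : cabs mu < 1 -> cabs (l mu) < 1.
  move=> mu1; apply: le_lt_trans (le_normcD _ _) _.
  by rewrite cabsM half; lra.
have l_neq0 mu : cabs mu < 1 -> l mu != 0.
  apply: contraTneq => lmu; have -> : mu = -1.
    have -> : mu = 2 * l mu - 1 by rewrite /l; field.
    by rewrite lmu mulr0 sub0r.
  by rewrite normcN ComplexField.Normc.normc1 ltxx.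
have lu mu : cabs mu < 1 -> uball m (l mu *: u).
  by move=> /l_lt1; rewrite /uball /= enormZ u1 mulr1.
pose q mu := dot (g (l mu *: u)) c * (l mu)^-1.
pose k mu := 1 - q mu.
have q_le1 mu : cabs mu < 1 -> cabs (q mu) <= 1.
  move=> mu1; rewrite /q cabsM cabsV ler_pdivrMr ?cabs_gt0 ?l_neq0 // mul1r.
  apply: le_trans (dot_le _ _) _; rewrite c1 mulr1 gn; last exact: lu.
  by rewrite enormZ u1 mulr1.
have ld mu : differentiable l mu.
  have -> : l = (fun mu => 2^-1 * (cst 1 mu) + 2^-1 * mu).
    by apply/funext => w; rewrite /l /cst mulr1 addrC.
  by apply: differentiable_lin_comb; exact: differentiable_cst.
have kd mu : cabs mu < 1 -> differentiable k mu.
  move=> mu1; apply: (@differentiableB _ _ _ (cst (1 : R[i])) q); first exact: differentiable_cst.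
  apply: (@differentiableM _ _ (fun mu => dot (g (l mu *: u)) c) (fun mu => (l mu)^-1)).
    apply: (@differentiable_comp _ _ _ _ l (fun t : R[i] => dot (g (t *: u)) c)); first exact: ld.
    by apply: differentiable_dotl; apply: differentiable_slice; apply: gd; exact: lu.
  by apply: (@differentiableV _ _ l); [exact: ld | exact: l_neq0].
have k_ge0 mu : cabs mu < 1 -> 0 <= complex.Re (k mu).
  move=> /q_le1 qmu; rewrite /k raddfB /= subr_ge0.
  exact: le_trans (ler_norm _) (le_trans (Re_le_cabs _) qmu).
have k0 : k 0 = 0.
  rewrite /k /q /l mulr0 add0r invrK mulrC -dotZl -/c dotxx c1 expr1n.
  by rewrite rmorph1 subrr.
clearbody c; move=> t /andP[t0 t1].
pose mu := (2 * t - 1)%:C%C.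
have mu1 : cabs mu < 1.
  by rewrite cabs_real; apply/ltr_normlP; split; lra.
have lmu : l mu = t%:C%C.
  by rewrite /l /mu c2 -fmorphV -rmorphM -rmorphD; congr (_%:C%C); field.
have := Re_nonneg_vanishing kd k_ge0 k0 mu1; rewrite /k /q lmu => /eqP.
rewrite subr_eq0 => /eqP E.
have tn0 : t%:C%C != 0 :> R[i] by rewrite -(rmorph0 (real_complex R)) (inj_eq (@complexI R)) gt_eqF.
have dE : dot (g (t%:C%C *: u)) c = t%:C%C.
  by rewrite -[LHS](divfK tn0) -E mul1r.
have tu : uball m (t%:C%C *: u) by rewrite -lmu; exact: lu.
apply/eqP; rewrite -subr_eq0 -enorm_eq0 -sqrf_eq0; apply/eqP/complexI.
rewrite -dotxx dotBl !dotBr !dotZl !dotZr -(dotJ _ c) dE !dotxx gn // enormZ u1 c1.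
rewrite !conjc_real cabs_real gtr0_norm // expr1n mulr1.
by rewrite rmorphXn rmorph1 rmorph0 /=; ring.
Qed.

(** Along each ray g is t |-> t c by [norm_preserving_ray], so g agrees with
  its differential at 0. *)
Lemma norm_preserving_linear (R : realType) (m n : nat) (g : 'rV[R[i]]_m -> 'rV[R[i]]_n) :
  holomorphic_on (uball m) g -> (forall z, uball m z -> enorm (g z) = enorm z) ->
  exists2 U : {linear 'rV[R[i]]_m -> 'rV[R[i]]_n},
    (forall z, uball m z -> g z = U z) & (forall z, enorm (U z) = enorm z).
Proof.
move=> gd gn.
have b0 : uball m (0 : 'rV[R[i]]_m) by rewrite /uball /= enorm0.
have g0 : g 0 = 0 by apply/eqP; rewrite -enorm_eq0 gn // enorm0.
have gU z : uball m z -> g z = 'd g (0 : 'rV[R[i]]_m) z.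
  move=> z1; have [->|z0] := eqVneq z 0; first by rewrite g0 linear0.
  have nz : 0 < enorm z by rewrite lt_def enorm_eq0 z0 enorm_ge0.
  pose u := ((enorm z)^-1)%:C%C *: z.
  have u1 : enorm u = 1 by rewrite enormZ cabs_real gtr0_norm ?invr_gt0 // mulVf ?gt_eqF.
  have zE : z = (enorm z)%:C%C *: u.
    by rewrite /u scalerA -rmorphM mulfV ?gt_eqF // rmorph1 scale1r.
  have [c cP] := norm_preserving_ray gd gn u1.
  suff -> : 'd g (0 : 'rV[R[i]]_m) z = (enorm z)%:C%C *: c by rewrite {1}zE cP ?nz.
  rewrite {1}zE linearZ /=; congr (_ *: _); apply/eqP.
  rewrite -subr_eq0 -enorm_eq0 eq_le enorm_ge0 andbT.
  apply/ler_addgt0Pr => e e0; rewrite add0r.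
  have n0 : 0 < n.+1%:R :> R by rewrite ltr0n.
  have eC : 0 < (e / n.+1%:R)%:C%C :> R[i] by rewrite ltcR divr_gt0.
  have [_ /complex_pos[r r0 ->] rP] := differentiable_jet (gd 0 b0) eC.
  pose t := Num.min (r / 2) 2^-1.
  have t0 : 0 < t by rewrite lt_min divr_gt0 //= invr_gt0.
  have tr : t < r.
    by apply: le_lt_trans (_ : r / 2 < r); [rewrite ge_min lexx | lra].
  have t1 : t < 1.
    by apply: le_lt_trans (_ : 2^-1 < 1 :> R); [rewrite ge_min lexx orbT | lra].
  have nu : `|u| <= 1 by apply: le_trans (norm_le_enorm _) _; rewrite u1.
  have ntu : `|t%:C%C *: u| <= t%:C%C.
    by rewrite normrZ normr_cabs cabs_real gtr0_norm // ler_piMr // ler0c ltW.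
  have tur : `|t%:C%C *: u| < r%:C%C by apply: le_lt_trans ntu _; rewrite ltcR.
  have := rP _ tur; rewrite addr0 g0 subr0 cP ?t0 // linearZ /= => H.
  have {}H : `|t%:C%C *: (c - 'd g (0 : 'rV[R[i]]_m) u)| <=
     (e / n.+1%:R)%:C%C * `|t%:C%C *: u| by rewrite scalerBr.
  rewrite normrZ normr_cabs cabs_real gtr0_norm // in H.
  have /complex_realP[s sE] : `|c - 'd g (0 : 'rV[R[i]]_m) u| \is Num.real by exact: normr_real.
  have {}H : s <= e / n.+1%:R.
    have : (t * s)%:C%C <= (e / n.+1%:R * t)%:C%C :> R[i].
      rewrite (rmorphM _ t) (rmorphM _ (e / n.+1%:R)) /= -sE.
    by apply: le_trans H _; rewrite ler_wpM2l // ltW.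
    by rewrite lecR mulrC ler_pM2r.
  rewrite enormB.
  apply/ler_addgt0Pr => d d0.
  have : `|c - 'd g (0 : 'rV[R[i]]_m) u| < (e / n.+1%:R + d / n.+1%:R)%:C%C.
    rewrite sE ltcR; apply: le_lt_trans H _.
    by rewrite ltrDl divr_gt0.
  move=> /enorm_lt_norm H'; apply: le_trans H' _; rewrite -mulrDl mulrCA.
  have ed : 0 <= e + d by rewrite addr_ge0 // ltW.
  apply: ler_piMr => //.
  by rewrite ler_pdivrMr // mul1r ler_nat.
exists ('d g (0 : 'rV[R[i]]_m)) => // z.
pose t := (2 * (enorm z + 1))^-1.
have p0 : 0 < enorm z + 1 by rewrite ltr_wpDl ?enorm_ge0.
have t0 : 0 < t by rewrite invr_gt0 mulr_gt0.
have tz : uball m (t%:C%C *: z).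
  rewrite /uball /= enormZ cabs_real gtr0_norm // mulrC ltr_pdivrMr ?mulr_gt0 //.
  by have := enorm_ge0 z; lra.
have := gn _ tz; rewrite gU // linearZ /= !enormZ cabs_real gtr0_norm //.
by move=> /(mulfI (lt0r_neq0 t0)).
Qed.

(** Polarization; the imaginary part is the real part for i w. *)
Lemma isometry_dot (R : realType) (m n : nat) (U : {linear 'rV[R[i]]_m -> 'rV[R[i]]_n}) :
  (forall z, enorm (U z) = enorm z) -> forall z w, dot (U z) (U w) = dot z w.
Proof.
move=> Un.
have ReE z w : complex.Re (dot (U z) (U w)) = complex.Re (dot z w).
  have := Un (z + w); rewrite linearD => /(congr1 (fun x => x ^+ 2)) /=.
  by rewrite !enorm_sqrD !Un => H; lra.
move=> z w; apply/eqP; rewrite eq_complex ReE eqxx /=; apply/eqP.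
have := ReE z ('i%C *: w); rewrite linearZ /= !dotZr.
by case: (dot (U z) (U w)) (dot z w) => a b [c d] /=; lra.
Qed.

(** * The Hermitian form of signature (d, 1) *)

Definition hform (R : realType) (d : nat) (X Y : 'rV[R[i]]_d * R[i]) : R[i] :=
  dot X.1 Y.1 - X.2 * (Y.2)^*%C.

Definition homog (R : realType) (d : nat) (z : 'rV[R[i]]_d) : 'rV[R[i]]_d * R[i] :=
  (z, 1).

Definition dehomog (R : realType) (d : nat) (X : 'rV[R[i]]_d * R[i]) : 'rV[R[i]]_d :=
  X.2^-1 *: X.1.

(** The linear isometries of the form h.  They are handled as plain maps, so
  that compositions and iterates need no bundling. *)
Definition lorentz (R : realType) (d : nat)
    (A : 'rV[R[i]]_d * R[i] -> 'rV[R[i]]_d * R[i]) : Prop :=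
  (forall c X Y, A (c *: X + Y) = c *: A X + A Y) /\
  (forall X Y, hform (A X) (A Y) = hform X Y).

Section HermitianForm.
Variables (R : realType) (d : nat).
Implicit Types (X Y Z : 'rV[R[i]]_d * R[i]) (z w : 'rV[R[i]]_d) (c : R[i]).

Lemma hformDl X Y Z : hform (X + Y) Z = hform X Z + hform Y Z.
Proof. by rewrite /hform /= dotDl mulrDl; ring. Qed.

Lemma hformZl c X Z : hform (c *: X) Z = c * hform X Z.
Proof. by rewrite /hform /= dotZl mulrBr mulrA. Qed.

Lemma hformJ X Y : (hform X Y)^*%C = hform Y X.
Proof. by rewrite /hform rmorphB rmorphM /= dotJ conjcK mulrC. Qed.

Lemma hformDr Z X Y : hform Z (X + Y) = hform Z X + hform Z Y.
Proof. by rewrite -hformJ hformDl rmorphD /= !hformJ. Qed.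

Lemma hformZr c Z X : hform Z (c *: X) = c^*%C * hform Z X.
Proof. by rewrite -hformJ hformZl rmorphM /= hformJ. Qed.

Lemma hformNl X Z : hform (- X) Z = - hform X Z.
Proof. by rewrite -scaleN1r hformZl mulN1r. Qed.

Lemma hformNr Z X : hform Z (- X) = - hform Z X.
Proof. by rewrite -hformJ hformNl rmorphN /= hformJ. Qed.

Lemma hformBl X Y Z : hform (X - Y) Z = hform X Z - hform Y Z.
Proof. by rewrite hformDl hformNl. Qed.

Lemma hformBr Z X Y : hform Z (X - Y) = hform Z X - hform Z Y.
Proof. by rewrite hformDr hformNr. Qed.

Lemma hformXX X : hform X X = (enorm X.1 ^+ 2 - cabs X.2 ^+ 2)%:C%C.
Proof. by rewrite /hform dotxx -sqr_normc normr_cabs -rmorphXn -rmorphB. Qed.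

Lemma hform_homog z w : hform (homog z) (homog w) = dot z w - 1.
Proof. by rewrite -[LHS]/(dot z w - 1 * 1^*%C) mul1r conjc1. Qed.

Lemma hform_homog_self z : hform (homog z) (homog z) = (enorm z ^+ 2 - 1)%:C%C.
Proof. by rewrite hform_homog dotxx rmorphB rmorph1. Qed.

Lemma homogE X : X.2 != 0 -> X = X.2 *: homog (dehomog X).
Proof.
case: X => x t /= t0; rewrite /homog /dehomog /=; congr (_, _).
  by rewrite /= scalerA mulfV // scale1r.
by rewrite /= -[_ *: _]/(t * 1) mulr1.
Qed.

Lemma homogK z : dehomog (homog z) = z.
Proof. by rewrite /dehomog /homog /= invr1 scale1r. Qed.

Lemma dehomogZ c X : c != 0 -> dehomog (c *: X) = dehomog X.
Proof.
case: X => x t c0; rewrite /dehomog /= -[c *: t]/(c * t) invfM scalerA mulrAC.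
by rewrite mulVf // mul1r.
Qed.

Lemma lorentzZ A c X : lorentz A -> A (c *: X) = c *: A X.
Proof.
move=> [lin _]; have A0 : A 0 = 0.
  have := lin 1 0 0; rewrite !scale1r addr0 => /(congr1 (fun Y => Y - A 0)).
  by rewrite addrK subrr => <-.
by rewrite -[c *: X]addr0 lin A0 addr0.
Qed.

Lemma lorentzD A X Y : lorentz A -> A (X + Y) = A X + A Y.
Proof. by move=> [lin _]; rewrite -[X in X + Y]scale1r lin scale1r. Qed.

(** A vector of the closed cone h <= 0 with zero last coordinate is 0, and an
  isometry of the nondegenerate form h does not kill (z, 1). *)
Lemma lorentz_homog_neq0 A z : lorentz A -> enorm z <= 1 -> (A (homog z)).2 != 0.
Proof.
move=> LA z1; have [_ iso] := LA; apply/eqP => t0.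
have x0 : (A (homog z)).1 = 0.
  apply/eqP; rewrite -enorm_eq0 -sqrf_eq0 eq_le sqr_ge0 andbT.
  have := hformXX (A (homog z)); rewrite iso hform_homog_self t0 cabs0 expr0n subr0.
  by move=> /complexI <-; rewrite subr_le0 expr_le1 // enorm_ge0.
have := iso (homog z) (0, 1).
rewrite {1}/hform x0 t0 dot0l mul0r subrr.
rewrite -[RHS]/(dot z 0 - 1 * 1^*%C) dot0r mul1r conjc1 sub0r => /eqP.
by rewrite eq_sym oppr_eq0 oner_eq0.
Qed.

Lemma lorentz_homogE A z : lorentz A -> enorm z <= 1 ->
  A (homog z) = (A (homog z)).2 *: homog (dehomog (A (homog z))).
Proof. by move=> LA z1; apply: homogE; exact: lorentz_homog_neq0. Qed.

(** The form h of (z, 1) is |z|^2 - 1; it is preserved by A, and A (z, 1) is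
  its last coordinate times the lift of the image of z. *)
Lemma lorentz_norm A z : lorentz A -> enorm z <= 1 ->
  1 - enorm z ^+ 2 =
  cabs (A (homog z)).2 ^+ 2 * (1 - enorm (dehomog (A (homog z))) ^+ 2).
Proof.
move=> LA z1; have [_ iso] := LA.
have := iso (homog z) (homog z); rewrite {1 2}(lorentz_homogE LA z1).
rewrite hformZl hformZr mulrA -sqr_normc normr_cabs !hform_homog_self.
by rewrite -rmorphXn -rmorphM => /complexI H; rewrite -[LHS]opprB -H; ring.
Qed.

Lemma lorentz_ball A z : lorentz A -> uball d z -> uball d (dehomog (A (homog z))).
Proof.
move=> LA z1; have zle := ltW z1; have := lorentz_norm LA zle.
have t0 : 0 < cabs (A (homog z)).2 ^+ 2.
  by rewrite exprn_gt0 // cabs_gt0 lorentz_homog_neq0.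
move=> E; have : 0 < 1 - enorm z ^+ 2 by rewrite subr_gt0 expr_lt1 // enorm_ge0.
by rewrite E pmulr_rgt0 // subr_gt0 expr_lt1 // enorm_ge0.
Qed.

Lemma dehomog_lorentz A X : lorentz A -> X.2 != 0 -> dehomog (A (homog (dehomog X))) = dehomog (A X).
Proof.
by move=> LA X0; rewrite [in RHS](homogE X0) lorentzZ // dehomogZ.
Qed.

End HermitianForm.

Section BallInvolution.
Variables (R : realType) (d : nat) (a : 'rV[R[i]]_d).
Hypothesis a1 : uball d a.

(** The involution exchanging 0 and a multiplies the component of z orthogonal
  to a by minus this number, over 1 - <z, a>. *)
Definition ball_root : R[i] := (Num.sqrt (1 - enorm a ^+ 2))%:C%C.

(** The lift to C^d x C of the involution of the ball exchanging 0 and a.  The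
  usual formula, with the projection to the line of a, has the denominator
  |a|^2; as (1 - s) / |a|^2 = 1 / (1 + s) for s = sqrt (1 - |a|^2), this form
  makes sense for a = 0 too. *)
Definition swap_hom (X : 'rV[R[i]]_d * R[i]) : 'rV[R[i]]_d * R[i] :=
  (ball_root^-1 *: ((X.2 - dot X.1 a / (1 + ball_root)) *: a - ball_root *: X.1),
   ball_root^-1 * (X.2 - dot X.1 a)).

Let s0 : 0 < Num.sqrt (1 - enorm a ^+ 2).
Proof. by rewrite sqrtr_gt0 subr_gt0 expr_lt1 // enorm_ge0. Qed.

Lemma ball_root_neq0 : ball_root != 0.
Proof. by rewrite -(rmorph0 (real_complex R)) (inj_eq (@complexI R)) gt_eqF. Qed.

Lemma ball_root1_neq0 : 1 + ball_root != 0.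
Proof.
rewrite -(rmorph1 (real_complex R)) -rmorphD -(rmorph0 (real_complex R)).
by rewrite (inj_eq (@complexI R)) gt_eqF // addr_gt0.
Qed.

Lemma ball_rootJ : ball_root^*%C = ball_root.
Proof. exact: conjc_real. Qed.

Lemma dot_ball_root : dot a a = 1 - ball_root ^+ 2.
Proof.
rewrite dotxx /ball_root -rmorphXn (@sqr_sqrtr _ (1 - _)); last first.
  by rewrite subr_ge0 expr_le1 ?enorm_ge0 // ltW.
by rewrite rmorphB rmorph1; ring.
Qed.

Lemma swap_hom_lorentz : lorentz swap_hom.
Proof.
have s1 := ball_root1_neq0; have sn := ball_root_neq0; have sJ := ball_rootJ.
have da := dot_ball_root.
split=> [c [x t] [y u]|[x t] [y u]]; rewrite /swap_hom /=.
  rewrite -[c *: t]/(c * t) dotDl dotZl; congr (_, _) => /=.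
    by apply/rowP => j; rewrite !mxE; field; rewrite s1 sn.
  by rewrite -[c *: _]/(c * _); ring.
rewrite /hform /= dotZl dotZr dotBl !dotBr !dotZl !dotZr da -(dotJ y a).
move: s1 sn sJ da; move: ball_root => s s1 sn sJ da.
rewrite !(rmorphM, rmorphB, rmorphD, fmorphV, rmorph1) /= !sJ.
by field; rewrite s1 sn.
Qed.

Lemma swap_homK : involutive swap_hom.
Proof.
have s1 := ball_root1_neq0; have sn := ball_root_neq0; have sJ := ball_rootJ.
have da := dot_ball_root.
move=> [x t]; rewrite /swap_hom /= !dotZl !dotBl !dotZl da.
move: s1 sn sJ da; move: ball_root => s s1 sn sJ da.
congr (_, _); last by field; rewrite s1 sn.
by apply/rowP => j; rewrite !mxE; field; rewrite s1 sn.
Qed.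

End BallInvolution.

(** * Automorphisms of the ball are projective *)

Lemma differentiable_mulf (R : realType) (V : normedModType R[i]) (f g : V -> R[i]) x :
  differentiable f x -> differentiable g x -> differentiable (fun y => f y * g y) x.
Proof. exact: differentiableM. Qed.

Lemma differentiable_subf (R : realType) (V : normedModType R[i]) (f g : V -> R[i]) x :
  differentiable f x -> differentiable g x -> differentiable (fun y => f y - g y) x.
Proof. exact: differentiableB. Qed.

Section MoebiusDifferentiable.
Variables (R : realType) (d : nat) (a : 'rV[R[i]]_d).
Hypothesis a1 : uball d a.

Definition moebius (z : 'rV[R[i]]_d) : 'rV[R[i]]_d := dehomog (swap_hom a (homog z)).

Lemma moebius_ball z : uball d z -> uball d (moebius z).
Proof. exact: lorentz_ball (swap_hom_lorentz a1). Qed.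

Lemma moebiusK z : uball d z -> moebius (moebius z) = z.
Proof.
move=> z1; rewrite /moebius dehomog_lorentz ?swap_homK ?homogK //.
  exact: swap_hom_lorentz.
by apply: lorentz_homog_neq0; [exact: swap_hom_lorentz | exact: ltW].
Qed.

Lemma moebius_center : moebius a = 0.
Proof.
have s1 := ball_root1_neq0 a1; have sn := ball_root_neq0 a1.
have da := dot_ball_root a1.
rewrite /moebius /dehomog /swap_hom /= da; move: s1 sn; move: (ball_root a) => s s1 sn.
suff -> : (1 - (1 - s ^+ 2) / (1 + s)) *: a - s *: a = 0 by rewrite !scaler0.
by apply/rowP => j; rewrite !mxE; field.
Qed.

Lemma moebius_differentiable z : uball d z -> differentiable moebius z.
Proof.
move=> z1; apply: differentiable_rV => j; pose s := ball_root a.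
pose den (y : 'rV[R[i]]_d) := s^-1 * (1 - dot y a).
pose num (y : 'rV[R[i]]_d) := s^-1 * ((1 - dot y a * (1 + s)^-1) * a ord0 j - s * y ord0 j).
have -> : (fun y => moebius y ord0 j) = (fun y => (den y)^-1 * num y).
  by apply/funext => y; rewrite /moebius /dehomog /swap_hom /= !mxE.
have dd : differentiable (fun y : 'rV[R[i]]_d => dot y a) z.
  by apply: (@differentiable_dotl _ _ _ id); exact: ex_diff.
have dc (c : R[i]) : differentiable (fun _ : 'rV[R[i]]_d => c) z.
  exact: differentiable_cst.
have dj : differentiable (fun y : 'rV[R[i]]_d => y ord0 j) z.
  exact: differentiable_coord.
apply: differentiable_mulf.
  apply: (@differentiableV _ _ den).
    exact: differentiable_mulf (dc _) (differentiable_subf (dc _) dd).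
  exact: (lorentz_homog_neq0 (swap_hom_lorentz a1) (ltW z1)).
apply: differentiable_mulf (dc _) (differentiable_subf _ (differentiable_mulf (dc _) dj)).
apply: differentiable_mulf (differentiable_subf (dc _) _) (dc _).
exact: differentiable_mulf dd (dc _).
Qed.

End MoebiusDifferentiable.

Section BallInverse.
Variables (R : realType) (d : nat) (g : 'rV[R[i]]_d -> 'rV[R[i]]_d).
Hypothesis g_aut : ball_aut g.

Lemma ball_autW z : uball d z -> uball d (g z).
Proof. by case: g_aut => [[fg _ _] _ _]; exact: fg. Qed.

Lemma ball_invW z : uball d z -> uball d (ball_inv g z).
Proof.
case: g_aut => [bg _ _] z1.
by have [fg _ _] := bijpinv_bij (fun=> 0) bg; exact: fg.
Qed.

Lemma ball_invK z : uball d z -> ball_inv g (g z) = z.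
Proof.
case: g_aut => [[_ ig _] _ _] z1.
by apply: (pinvKV _ ig); rewrite inE.
Qed.

End BallInverse.

(** With a = g(0), the composition of g with the involution exchanging 0 and a
  fixes 0.  The Schwarz lemma for it and for its inverse shows that it
  preserves norms, hence it is linear and unitary. *)
Lemma ball_aut_lorentz (R : realType) (d : nat) (g : 'rV[R[i]]_d -> 'rV[R[i]]_d) :
  ball_aut g -> exists2 A, lorentz A &
    forall z, uball d z -> g z = dehomog (A (homog z)).
Proof.
move=> g_aut; have [_ gd gid] := g_aut.
have b0 : uball d (0 : 'rV[R[i]]_d) by rewrite /uball /= enorm0.
pose a := g 0; have a1 : uball d a by exact: ball_autW.
pose h z := moebius a (g z); pose hi z := ball_inv g (moebius a z).
have hW z : uball d z -> uball d (h z).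
  by move=> z1; apply: moebius_ball => //; exact: ball_autW.
have hiW z : uball d z -> uball d (hi z).
  by move=> z1; apply: ball_invW => //; exact: moebius_ball.
have hK z : uball d z -> hi (h z) = z.
  by move=> z1; rewrite /hi /h moebiusK ?ball_invK //; exact: ball_autW.
have h0 : h 0 = 0 by rewrite /h moebius_center.
have hi0 : hi 0 = 0 by rewrite -{1}h0 hK.
have hd : holomorphic_on (uball d) h.
  move=> z z1; apply: (@differentiable_comp _ _ _ _ g (moebius a)); first exact: gd.
  by apply: moebius_differentiable => //; exact: ball_autW.
have hid : holomorphic_on (uball d) hi.
  move=> z z1; apply: (@differentiable_comp _ _ _ _ (moebius a) (ball_inv g)).
    exact: moebius_differentiable.
  by apply: gid; exact: moebius_ball.
have hn z : uball d z -> enorm (h z) = enorm z.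
  move=> z1; apply/eqP; rewrite eq_le; apply/andP; split.
    by apply: (schwarz_ball hd) => // w /hW /ltW.
  rewrite -{1}(hK z z1); apply: (schwarz_ball hid) => //; last exact: hW.
  by move=> w /hiW /ltW.
have [U hU Un] := norm_preserving_linear hd hn.
have Ud := isometry_dot Un; have [ml mi] := swap_hom_lorentz a1.
exists (fun X => swap_hom a (U X.1, X.2)).
  split=> [c X Y|X Y]; last by rewrite mi /hform /= Ud.
  rewrite -ml; suff E : U (c *: X + Y).1 = c *: U X.1 + U Y.1 by rewrite E.
  exact: linearP.
move=> z z1; have hz : moebius a (g z) = U z := hU z z1.
by rewrite -(moebiusK a1 (ball_autW g_aut z1)) hz.
Qed.

Lemma uball_dense (R : realType) (d : nat) (x : 'rV[R[i]]_d) (r : R) :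
  enorm x <= 1 -> 0 < r -> exists y, uball d y /\ enorm (y - x) < r.
Proof.
move=> x1 r0; pose t := Num.min (r / 2) 1.
have t0 : 0 < t by rewrite lt_min ltr01 divr_gt0.
have t1 : t <= 1 by rewrite ge_min lexx orbT.
have tr : t < r by apply: le_lt_trans (_ : r / 2 < r); [rewrite ge_min lexx | lra].
exists ((1 - t)%:C%C *: x); split.
  rewrite /uball /= enormZ cabs_real ger0_norm ?subr_ge0 //.
  apply: le_lt_trans (_ : 1 - t < 1); last by rewrite gtrBl.
  by rewrite ler_piMr ?subr_ge0.
have -> : (1 - t)%:C%C *: x - x = - (t%:C%C *: x).
  by rewrite rmorphB rmorph1 scalerBl scale1r addrC addKr.
rewrite enormN enormZ cabs_real gtr0_norm //.
by apply: le_lt_trans tr; rewrite ler_piMr // ltW.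
Qed.

Section LorentzContinuity.
Variables (R : realType) (d : nat) (A : 'rV[R[i]]_d * R[i] -> 'rV[R[i]]_d * R[i]).
Hypothesis LA : lorentz A.

Lemma lorentz_bounded : exists2 K : R, 0 <= K & forall v,
  enorm (A (v, 0)).1 <= K * enorm v /\ cabs (A (v, 0)).2 <= K * enorm v.
Proof.
pose e j : 'rV[R[i]]_d * R[i] := (delta_mx ord0 j, 0).
pose K := \sum_j (enorm (A (e j)).1 + cabs (A (e j)).2).
have K0 : 0 <= K by apply: sumr_ge0 => j _; rewrite addr_ge0 ?enorm_ge0 ?cabs_ge0.
have A0 : A 0 = 0 by rewrite -(scale0r (0 : _ * _)) lorentzZ // !scale0r.
have AE v : A (v, 0) = \sum_j v ord0 j *: A (e j).
  have -> : (v, 0) = \sum_j v ord0 j *: e j :> _ * _.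
    rewrite {1}[v]row_sum_delta.
    elim/big_rec2 : _ => [//|j X y _ <-].
    suff E : v ord0 j *: (0 : R[i]) + 0 = 0 by rewrite -[in LHS]E.
    by rewrite addr0; exact: mulr0.
  elim/big_rec2 : _ => [//|j X Y _ <-].
  by rewrite lorentzD // lorentzZ.
exists K => // v; rewrite AE; split.
  have -> : (\sum_j v ord0 j *: A (e j)).1 = \sum_j v ord0 j *: (A (e j)).1.
    by elim/big_rec2 : _ => [//|j X Y _ <-].
  rewrite /K mulr_suml; elim/big_rec2 : _ => [|j x X _ IH].
    by rewrite enorm0.
  apply: le_trans (enormD _ _) _; apply: lerD => //.
  rewrite enormZ mulrC; apply: ler_pM; rewrite ?enorm_ge0 ?cabs_ge0 //.
    by rewrite lerDl cabs_ge0.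
  exact: enorm_coord.
have -> : (\sum_j v ord0 j *: A (e j)).2 = \sum_j v ord0 j * (A (e j)).2.
  by elim/big_rec2 : _ => [//|j X Y _ <-].
rewrite /K mulr_suml; elim/big_rec2 : _ => [|j x X _ IH].
  by rewrite cabs0.
apply: le_trans (le_normcD _ _) _; apply: lerD => //.
rewrite cabsM mulrC; apply: ler_pM; rewrite ?enorm_ge0 ?cabs_ge0 //.
  by rewrite lerDr enorm_ge0.
exact: enorm_coord.
Qed.

(** Numerator and last coordinate of A (y, 1) are Lipschitz in y, and the last
  coordinate does not vanish on the closed ball. *)
Lemma lorentz_cvg x : enorm x <= 1 -> forall e, 0 < e ->
  exists2 r : R, 0 < r & forall y, enorm y <= 1 -> enorm (y - x) < r ->
    enorm (dehomog (A (homog y)) - dehomog (A (homog x))) < e.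
Proof.
move=> x1 e e0; have [K K0 KP] := lorentz_bounded.
have t0 := lorentz_homog_neq0 LA x1; have ct : 0 < cabs (A (homog x)).2 by rewrite cabs_gt0.
pose t := cabs (A (homog x)).2; pose N := t + enorm (A (homog x)).1.
have N0 : 0 < N by rewrite ltr_pwDl ?enorm_ge0.
pose r := Num.min (t / (2 * (K + 1))) (e * t ^+ 2 / (2 * (K + 1) * N)).
have K1 : 0 < K + 1 by rewrite ltr_wpDl.
have r0 : 0 < r.
  by rewrite lt_min !divr_gt0 ?mulr_gt0 ?exprn_gt0 //.
exists r => // y y1 yx; have s0 := lorentz_homog_neq0 LA y1.
set v := y - x in yx.
have [xv tv] := KP v.
have yE : A (homog y) = A (homog x) + A (v, 0).
  rewrite -lorentzD //; congr (A (_, _)) => /=; first by rewrite /v addrC subrK.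
  by rewrite addr0.
have Kv : K * enorm v <= (K + 1) * r.
  by apply: ler_pM => //; rewrite ?enorm_ge0 ?lerDl // ltW.
have r1 : (K + 1) * r <= t / 2.
  have : r <= t / (2 * (K + 1)) by rewrite ge_min lexx.
  by rewrite ler_pdivlMr ?mulr_gt0 // => h; lra.
have st : t / 2 <= cabs (A (homog y)).2.
  have := cabs_dist (A (homog y)).2 (A (homog x)).2.
  rewrite yE /= [_ + (A (v, 0)).2 - _]addrC addKr => /ler_normlP[h _].
  by rewrite -/t in h; lra.
have Kvlt : K * enorm v * N <= (K + 1) * enorm v * N.
  by rewrite ler_pM2r // ler_wpM2r ?enorm_ge0 // lerDl.
have r2 : (K + 1) * enorm v * N < e * t ^+ 2 / 2.
  have h : enorm v < e * t ^+ 2 / (2 * (K + 1) * N).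
    by apply: lt_le_trans yx _; rewrite ge_min lexx orbT.
  by rewrite ltr_pdivlMr ?mulr_gt0 // in h; lra.
have -> : dehomog (A (homog y)) - dehomog (A (homog x)) =
   ((A (homog y)).2 * (A (homog x)).2)^-1 *:
   ((A (homog x)).2 *: (A (v, 0)).1 - (A (v, 0)).2 *: (A (homog x)).1).
  move: s0; rewrite /dehomog yE /= => s0.
  by apply/rowP => j; rewrite !mxE; field; rewrite s0 t0.
rewrite enormZ cabsV cabsM mulrC ltr_pdivrMr; last by rewrite mulr_gt0 ?cabs_gt0.
apply: le_lt_trans (enormBD _ _) _; rewrite !enormZ -/t.
have h1 : t * enorm (A (v, 0)).1 <= t * (K * enorm v) by rewrite ler_wpM2l ?cabs_ge0.
have h2 : cabs (A (v, 0)).2 * enorm (A (homog x)).1 <= K * enorm v * enorm (A (homog x)).1.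
  by rewrite ler_wpM2r ?enorm_ge0.
have h3 : e * (t / 2 * t) <= e * (cabs (A (homog y)).2 * t).
  by rewrite ler_wpM2l ?(ltW e0) // ler_wpM2r // ltW.
have NE : K * enorm v * N = t * (K * enorm v) + K * enorm v * enorm (A (homog x)).1.
  by rewrite /N; ring.
clear -h1 h2 h3 NE Kvlt r2; rewrite NE in Kvlt; lra.
Qed.

(** The formula for g inside the ball is continuous up to the boundary, so it
  computes the limit defining the extension. *)
Lemma ball_ext_lorentz (g : 'rV[R[i]]_d -> 'rV[R[i]]_d) x :
  (forall z, uball d z -> g z = dehomog (A (homog z))) -> enorm x <= 1 ->
  ball_ext g x = dehomog (A (homog x)).
Proof.
move=> gA x1.
have pf : ProperFilter (within (uball d) (nbhs x)).
  apply: Build_ProperFilter_ex => P /nbhs_enormP[r r0 rP].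
  have [y [y1 yx]] := uball_dense x1 r0.
  by exists y; exact: rP.
apply: cvg_lim; first exact: norm_hausdorff.
apply: cvg_enormP => e e0; have [r r0 rP] := lorentz_cvg x1 e0.
apply/nbhs_enormP; exists r => // y yr yb; rewrite gA //.
by apply: rP => //; exact: ltW.
Qed.

End LorentzContinuity.

(** After composition with the involution at a = f(0), the Schwarz lemma
  compares 1 - |.|^2 at z and at its image; going back costs the factor |1 -
  <f z, a>|^2 / (1 - |a|^2), which is bounded below. *)
Lemma schwarz_boundary_estimate (R : realType) (m n : nat)
    (f : 'rV[R[i]]_m -> 'rV[R[i]]_n) :
  holomorphic_on (uball m) f -> set_fun (uball m) (uball n) f ->
  exists2 c : R, 0 < c &
    forall z, uball m z -> c * (1 - enorm z ^+ 2) <= 1 - enorm (f z) ^+ 2.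
Proof.
move=> fd fW; pose a := f 0.
have b0 : uball m (0 : 'rV[R[i]]_m) by rewrite /uball /= enorm0.
have a1 : uball n a by exact: fW.
have La := swap_hom_lorentz a1.
pose g z := moebius a (f z).
have gd : holomorphic_on (uball m) g.
  move=> z z1; apply: (@differentiable_comp _ _ _ _ f (moebius a)); first exact: fd.
  by apply: moebius_differentiable => //; exact: fW.
have gz z : uball m z -> enorm (g z) <= enorm z.
  apply: (schwarz_ball gd); last exact: moebius_center.
  by move=> w w1; apply: ltW; apply: moebius_ball => //; exact: fW.
have [c c0 cP] : exists2 c : R, 0 < c &
    forall w, uball n w -> c <= cabs (swap_hom a (homog w)).2 ^+ 2.
  have r0 : 0 < cabs ((ball_root a)^-1) by rewrite cabs_gt0 invr_neq0 // ball_root_neq0.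
  have na : 0 < 1 - enorm a by rewrite subr_gt0.
  exists ((cabs ((ball_root a)^-1) * (1 - enorm a)) ^+ 2) => [|w w1].
    by rewrite exprn_gt0 // mulr_gt0.
  rewrite ler_sqr ?nnegrE ?cabs_ge0 ?mulr_ge0 ?(ltW r0) ?(ltW na) //.
  rewrite /swap_hom /= cabsM ler_pM2l //.
  have := cabs_dist 1 (dot w a); rewrite ComplexField.Normc.normc1 => /ler_normlP[_].
  have : enorm w * enorm a <= enorm a by rewrite ler_piMl ?enorm_ge0 // ltW.
  by have := dot_le w a; lra.
exists c => // z z1; have fz1 : uball n (f z) by exact: fW.
rewrite (lorentz_norm La (ltW fz1)) -/(moebius a (f z)) -/(g z).
have z0 : 0 <= 1 - enorm z ^+ 2 by rewrite subr_ge0 expr_le1 ?enorm_ge0 // ltW.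
have gz2 : enorm (g z) ^+ 2 <= enorm z ^+ 2 by rewrite ler_sqr ?nnegrE ?enorm_ge0 // gz.
by apply: ler_pM; [exact: ltW | | exact: cP | lra].
Qed.

(** * Orbits on the line through two boundary points *)

Lemma powR_small (R : realType) (b e : R) : 0 < b -> 0 < e ->
  exists2 t : R, 0 < t & forall x, 0 <= x <= t -> x `^ b <= e.
Proof.
move=> b0 e0; exists (e `^ b^-1); first exact: powR_gt0.
move=> x /andP[x0 xt].
have -> : e = (e `^ b^-1) `^ b by rewrite -powRrM mulVf ?gt_eqF // powRr1 // ltW.
by apply: ge0_ler_powR; rewrite ?nnegrE ?powR_ge0 // ltW.
Qed.

Lemma expr_unbounded (R : realType) (x N : R) : 1 < x -> exists n, N <= x ^+ n.
Proof.
move=> x1; have h n : n%:R * (x - 1) <= x ^+ n.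
  suff : 1 + n%:R * (x - 1) <= x ^+ n by lra.
  elim: n => [|n IH]; first by rewrite mul0r addr0 expr0.
  rewrite exprS -natr1.
  have : x * (1 + n%:R * (x - 1)) <= x * x ^+ n by rewrite ler_pM2l //; lra.
  have : 0 <= n%:R * (x - 1) ^+ 2 by rewrite mulr_ge0 // sqr_ge0.
  by lra.
have x0 : 0 < x - 1 by rewrite subr_gt0.
have [n nP] : exists n : nat, N / (x - 1) <= n%:R.
  exists (Num.bound `|N / (x - 1)|); apply: le_trans (ler_norm _) _.
  by apply: ltW; apply: archi_boundP.
by exists n; apply: le_trans (h n); rewrite -ler_pdivrMr.
Qed.

(** The place where alpha > 1/2 is used.  With x = C (1 - |z|^2), the squared
  distance of f(z) to f(p) is at most a constant times x^(2 alpha) = x * x^(2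
  alpha - 1), while 1 - |f z|^2 is at least a constant times x. *)
Lemma hoelder_small (R : realType) (m n : nat) (alpha c : R)
    (f : 'rV[R[i]]_m -> 'rV[R[i]]_n) (p : 'rV[R[i]]_m) :
  2^-1 < alpha -> hoelder_on alpha (cuball m) f -> 0 < c ->
  (forall z, uball m z -> c * (1 - enorm z ^+ 2) <= 1 - enorm (f z) ^+ 2) ->
  enorm p = 1 ->
  forall C e : R, 0 <= C -> 0 < e -> exists2 t : R, 0 < t & forall z, uball m z ->
    enorm (z - p) <= C * (1 - enorm z ^+ 2) -> 1 - enorm z ^+ 2 <= t ->
    enorm (f z - f p) ^+ 2 <= e * (1 - enorm (f z) ^+ 2).
Proof.
move=> halpha [h hP] c0 cP p1 C e C0 e0.
pose b := 2 * alpha - 1; have b0 : 0 < b by rewrite /b; lra.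
pose D := h ^+ 2 * C + 1; have D0 : 0 < D by rewrite ltr_wpDl // mulr_ge0 // sqr_ge0.
have [t t0 tP] := powR_small b0 (divr_gt0 (mulr_gt0 e0 c0) D0).
exists (t / (C + 1)) => [|z z1 zp zt]; first by rewrite divr_gt0 // ltr_wpDl.
pose x := C * (1 - enorm z ^+ 2); rewrite -/x in zp.
have d0 : 0 < 1 - enorm z ^+ 2 by rewrite subr_gt0 expr_lt1 // enorm_ge0.
have zp0 : 0 < enorm (z - p).
  rewrite lt_def enorm_ge0 andbT enorm_eq0 subr_eq0.
  by apply: contraTneq z1 => ->; rewrite /uball /= p1 ltxx.
have x0 : 0 < x by exact: lt_le_trans zp.
have xt : x <= t.
  have K0 : 0 < C + 1 by rewrite ltr_wpDl.
  rewrite ler_pdivlMr // in zt; apply: le_trans zt; rewrite /x mulrC ler_pM2l //.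
  by rewrite lerDl.
have xb : x `^ b <= e * c / D by apply: tP; rewrite xt ltW.
have fzp : enorm (f z - f p) <= `|h| * x `^ alpha.
  apply: le_trans (hP z p (ltW z1) _) _; first by rewrite /cuball /= p1.
  apply: le_trans (_ : `|h| * enorm (z - p) `^ alpha <= _).
    by rewrite ler_wpM2r ?powR_ge0 // ler_norm.
  rewrite ler_wpM2l //; apply: ge0_ler_powR; rewrite ?nnegrE ?enorm_ge0 ?(ltW x0) //; lra.
have xx : x `^ alpha * x `^ alpha = x * x `^ b.
  have xn : x != 0 by rewrite gt_eqF.
  rewrite -{3}(powRr1 (ltW x0)) -!powRD ?xn ?implybT //.
  by congr (_ `^ _); rewrite /b; ring.
have : enorm (f z - f p) ^+ 2 <= h ^+ 2 * (x * x `^ b).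
  rewrite -xx -(real_normK (num_real h)).
  have -> : `|h| ^+ 2 * (x `^ alpha * x `^ alpha) = (`|h| * x `^ alpha) ^+ 2 by ring.
  by rewrite ler_sqr ?nnegrE ?enorm_ge0 ?mulr_ge0 ?powR_ge0.
move=> H; apply: le_trans H _.
have h1 : h ^+ 2 * (x * x `^ b) <= h ^+ 2 * (x * (e * c / D)).
  by rewrite ler_wpM2l ?sqr_ge0 // ler_wpM2l // ltW.
apply: le_trans h1 _.
have h2 : e * (c * (1 - enorm z ^+ 2)) <= e * (1 - enorm (f z) ^+ 2).
  by rewrite ler_pM2l // cP.
apply: le_trans h2.
have -> : h ^+ 2 * (x * (e * c / D)) = (h ^+ 2 * C) / D * (e * (c * (1 - enorm z ^+ 2))).
  by rewrite /x; field; rewrite gt_eqF.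
rewrite ler_piMl ?mulr_ge0 ?ltW //.
by rewrite ltr_pdivrMr // mul1r /D ltrDl.
Qed.

Section Pencil.
Variables (R : realType) (m : nat) (p q : 'rV[R[i]]_m) (a b : R[i]) (eta : R).
Hypotheses (p1 : enorm p = 1) (q1 : enorm q = 1).
Let pencil (mu : R[i]) : 'rV[R[i]]_m * R[i] :=
  (a * mu) *: homog p + (b * (mu^*%C)^-1) *: homog q.
Hypothesis eta0 : 0 < eta.
Hypothesis pencilN : hform (pencil 1) (pencil 1) = (- eta)%:C%C.
Hypothesis a0 : a != 0.

Lemma hform_isotropic (x : 'rV[R[i]]_m) : enorm x = 1 -> hform (homog x) (homog x) = 0.
Proof. by move=> x1; rewrite hform_homog_self x1 expr1n subrr. Qed.

(** The vector a mu X + (b / conj mu) Y stays on a level set of h as mu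
  varies.  For mu = l^n this is the n-th iterate of an isometry with
  eigenvalues l and 1 / conj l. *)
Lemma hform_pencil (X Y : 'rV[R[i]]_m * R[i]) (mu : R[i]) :
  hform X X = 0 -> hform Y Y = 0 -> mu != 0 ->
  hform ((a * mu) *: X + (b * (mu^*%C)^-1) *: Y) ((a * mu) *: X + (b * (mu^*%C)^-1) *: Y)
  = a * b^*%C * hform X Y + b * a^*%C * hform Y X.
Proof.
move=> X0 Y0 mu0; have mJ0 : mu^*%C != 0 by rewrite conjc_eq0.
rewrite hformDl !hformDr !hformZl !hformZr X0 Y0; move: (hform X Y) (hform Y X) => u v.
rewrite !rmorphM fmorphV /= conjcK; field.
by rewrite mu0 mJ0.
Qed.

Lemma pencil_hform mu : mu != 0 -> hform (pencil mu) (pencil mu) = (- eta)%:C%C.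
Proof.
have iP := hform_isotropic p1; have iQ := hform_isotropic q1.
move=> mu0; have e1 := hform_pencil iP iQ mu0.
have e2 := hform_pencil iP iQ (oner_neq0 R[i]).
exact: etrans e1 (etrans (esym e2) pencilN).
Qed.

Lemma pencil2_neq0 mu : mu != 0 -> (pencil mu).2 != 0.
Proof.
move=> mu0; apply/eqP => E; have := pencil_hform mu0.
rewrite hformXX E cabs0 expr0n subr0 => /complexI H.
by have := sqr_ge0 (enorm (pencil mu).1); rewrite H oppr_ge0 leNgt eta0.
Qed.

Lemma pencil_norm mu : mu != 0 ->
  cabs (pencil mu).2 ^+ 2 * (1 - enorm (dehomog (pencil mu)) ^+ 2) = eta.
Proof.
move=> mu0; have := pencil_hform mu0.
rewrite {1 2}(homogE (pencil2_neq0 mu0)) hformZl hformZr mulrA -sqr_normc normr_cabs.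
by rewrite hform_homog_self -rmorphXn -rmorphM => /complexI H; rewrite -[RHS]opprK -H; ring.
Qed.

Lemma pencil_ball mu : mu != 0 -> uball m (dehomog (pencil mu)).
Proof.
move=> mu0; have := pencil_norm mu0 => E.
have s0 : 0 < cabs (pencil mu).2 ^+ 2 by rewrite exprn_gt0 // cabs_gt0 pencil2_neq0.
by move: eta0; rewrite -E pmulr_rgt0 // subr_gt0 expr_lt1 // enorm_ge0.
Qed.

(** The difference with p is (b / conj mu) (q - p) / s with s the last
  coordinate, and 1 - |.|^2 = eta / |s|^2.  Their ratio is of order |s| /
  |mu|, which is bounded. *)
Lemma pencil_attracted : exists2 C : R, 0 <= C & forall mu, 1 <= cabs mu ->
  enorm (dehomog (pencil mu) - p) <= C * (1 - enorm (dehomog (pencil mu)) ^+ 2).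
Proof.
exists (cabs b * enorm (q - p) * (cabs a + cabs b) / eta).
  by rewrite divr_ge0 ?(ltW eta0) // !mulr_ge0 ?addr_ge0 ?cabs_ge0 ?enorm_ge0.
move=> mu mu1; have cm : 0 < cabs mu by exact: lt_le_trans mu1.
have mu0 : mu != 0 by rewrite -cabs_gt0.
have s0 := pencil2_neq0 mu0; have N := pencil_norm mu0.
have sE : (pencil mu).2 = a * mu + b * (mu^*%C)^-1.
  by rewrite /pencil /homog /= -[(a * mu) *: _]/(a * mu * 1) -[(b / _) *: _]/(b / _ * 1) !mulr1.
have cs : cabs (pencil mu).2 <= (cabs a + cabs b) * cabs mu.
  rewrite sE; apply: le_trans (le_normcD _ _) _; rewrite mulrDl !cabsM cabsV lerD2l.
  rewrite ler_wpM2l ?cabs_ge0 //.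
  have -> : cabs mu^*%C = cabs mu by apply: complexI; rewrite -!normr_cabs normcJ.
  by rewrite (le_trans _ mu1) // invf_le1.
have -> : dehomog (pencil mu) - p = (pencil mu).2^-1 *: ((b * (mu^*%C)^-1) *: (q - p)).
  move: s0; rewrite /dehomog sE {1}/pencil /homog /=; move: (mu^*%C)^-1 => nu s0.
  by apply/rowP => j; rewrite !mxE; field.
rewrite [X in X <= _]enormZ [enorm (_ *: (q - p))]enormZ cabsV cabsM cabsV.
have -> : cabs mu^*%C = cabs mu by apply: complexI; rewrite -!normr_cabs normcJ.
have s1 : 0 < cabs (pencil mu).2 by rewrite cabs_gt0.
have d0 : 0 < 1 - enorm (dehomog (pencil mu)) ^+ 2.
  by rewrite subr_gt0 expr_lt1 ?enorm_ge0 //; exact: pencil_ball.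
move: N cs s1 d0; move: (cabs _.2) (1 - enorm (dehomog _) ^+ 2) => s d <- cs s1 d0.
have -> : cabs b * enorm (q - p) * (cabs a + cabs b) / (s ^+ 2 * d) * d =
  s^-1 * ((cabs b * (cabs mu)^-1) * enorm (q - p)) * ((cabs a + cabs b) * cabs mu / s).
  by field; rewrite !gt_eqF.
apply: ler_peMr; last by rewrite ler_pdivlMr // mul1r.
by rewrite !mulr_ge0 ?invr_ge0 ?cabs_ge0 ?enorm_ge0 // ltW.
Qed.

(** By [pencil_norm], 1 - |.|^2 is eta divided by the squared modulus of the
  last coordinate a mu + b / conj mu, which grows with mu. *)
Lemma pencil_to_boundary t : 0 < t -> exists N, forall mu, N <= cabs mu ->
  1 <= cabs mu /\ 1 - enorm (dehomog (pencil mu)) ^+ 2 <= t.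
Proof.
move=> t0; pose S := eta / t + 1.
have ca : 0 < cabs a by rewrite cabs_gt0.
exists (Num.max 1 ((S + cabs b) / cabs a)) => mu; rewrite ge_max => /andP[mu1 muN].
split => //; have cm : 0 < cabs mu by exact: lt_le_trans mu1.
have mu0 : mu != 0 by rewrite -cabs_gt0.
have sE : (pencil mu).2 = a * mu + b * (mu^*%C)^-1.
  by rewrite /pencil /homog /= -[(a * mu) *: _]/(a * mu * 1) -[(b / _) *: _]/(b / _ * 1) !mulr1.
rewrite ler_pdivrMr // in muN.
have S1 : 1 <= S by rewrite lerDr divr_ge0 // ltW.
have sS : S <= cabs (pencil mu).2.
  have h1 : cabs (a * mu) <= cabs (pencil mu).2 + cabs (b * (mu^*%C)^-1).
    have -> : a * mu = (pencil mu).2 - b * (mu^*%C)^-1 by rewrite sE addrK.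
    by apply: le_trans (le_normcD _ _) _; rewrite normcN.
  have h2 : cabs (b * (mu^*%C)^-1) <= cabs b.
    rewrite cabsM cabsV; have -> : cabs mu^*%C = cabs mu.
      by apply: complexI; rewrite -!normr_cabs normcJ.
    by rewrite ler_piMr ?cabs_ge0 // invf_le1.
  by rewrite cabsM in h1; lra.
have N := pencil_norm mu0.
have d0 : 0 < 1 - enorm (dehomog (pencil mu)) ^+ 2.
  by rewrite subr_gt0 expr_lt1 ?enorm_ge0 //; exact: pencil_ball.
have s2 : S <= cabs (pencil mu).2 ^+ 2.
  apply: (le_trans sS); rewrite expr2 ler_peMl ?cabs_ge0 //.
  exact: le_trans S1 sS.
have : S * (1 - enorm (dehomog (pencil mu)) ^+ 2) <= eta by rewrite -N ler_wpM2r // ltW.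
move: d0; move: (1 - enorm _ ^+ 2) => d d0 H.
have : eta / t * d <= eta by rewrite /S mulrDl in H; lra.
by rewrite mulrAC -mulrA ger_pMr // ler_pdivrMr // mul1r.
Qed.

End Pencil.

(** * Distance to the line through two fixed boundary points *)

Lemma lorentz_iter (R : realType) (d : nat) (A : 'rV[R[i]]_d * R[i] -> 'rV[R[i]]_d * R[i]) n :
  lorentz A -> lorentz (iter n A).
Proof.
move=> [lA iA]; elim: n => [|n [lI iI]]; first by split.
by split=> [c X Y|X Y] /=; [rewrite lI lA | rewrite iA iI].
Qed.

Lemma eigen_iter (R : realType) (d : nat) (A : 'rV[R[i]]_d * R[i] -> 'rV[R[i]]_d * R[i])
    (X : 'rV[R[i]]_d * R[i]) (l : R[i]) n :
  lorentz A -> A X = l *: X -> iter n A X = l ^+ n *: X.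
Proof.
move=> LA AX; elim: n => [|n IH]; first by rewrite expr0 scale1r.
by rewrite /= IH lorentzZ // AX scalerA -exprSr.
Qed.

Lemma cabsX (R : realType) (z : R[i]) n : cabs (z ^+ n) = cabs z ^+ n.
Proof.
elim: n => [|n IH]; first by rewrite !expr0 ComplexField.Normc.normc1.
by rewrite !exprS cabsM IH.
Qed.

Lemma cabsJ (R : realType) (z : R[i]) : cabs z^*%C = cabs z.
Proof. by apply: complexI; rewrite -!normr_cabs normcJ. Qed.

Section SpherePair.
Variables (R : realType) (d : nat) (x y : 'rV[R[i]]_d).
Hypotheses (x1 : enorm x = 1) (y1 : enorm y = 1).

(** Equality in the Cauchy-Schwarz inequality for unit vectors. *)
Lemma hform_sphere_neq0 : x <> y -> hform (homog x) (homog y) != 0.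
Proof.
move=> xy; rewrite hform_homog subr_eq0; apply/eqP => E; apply: xy.
apply/eqP; rewrite -subr_eq0 -enorm_eq0 -sqrf_eq0; apply/eqP/complexI.
rewrite -dotxx dotBl !dotBr -(dotJ x y) E !dotxx x1 y1 conjc1 expr1n rmorph1.
by rewrite subrr.
Qed.

(** By the parallelogram identity, |x + y|^2 = 4 - |x - y|^2. *)
Lemma midpoint_ball : x <> y -> uball d ((2^-1 : R[i]) *: (x + y)).
Proof.
move=> xy; have c2 : cabs (2^-1 : R[i]) = 2^-1.
  have -> : (2 : R[i]) = (2 : R)%:C%C by rewrite rmorph_nat.
  by rewrite -fmorphV cabs_real gtr0_norm // invr_gt0.
have par : enorm (x + y) ^+ 2 = 4 - enorm (x - y) ^+ 2.
  rewrite !enorm_sqrD enormN x1 y1 dotNr raddfN /=; ring.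
have xy0 : 0 < enorm (x - y) ^+ 2.
  by rewrite exprn_gt0 // lt_def enorm_ge0 enorm_eq0 subr_eq0 andbT; apply/eqP.
rewrite /uball /= enormZ c2; have : enorm (x + y) < 2.
  rewrite -ltr_sqr ?nnegrE ?enorm_ge0 // par.
  have -> : (2 : R) ^+ 2 = 4 by ring.
  by lra.
by lra.
Qed.

Lemma eigen_pair A (l k : R[i]) : lorentz A -> x <> y ->
  A (homog x) = l *: homog x -> A (homog y) = k *: homog y -> l * k^*%C = 1.
Proof.
move=> [_ iA] xy Ax Ay; have := iA (homog x) (homog y).
rewrite Ax Ay hformZl hformZr mulrA => /(canRL (mulfK (hform_sphere_neq0 xy))).
by rewrite mulfV ?hform_sphere_neq0.
Qed.

Lemma fixed_eigen A (z : 'rV[R[i]]_d) : lorentz A -> enorm z <= 1 ->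
  dehomog (A (homog z)) = z -> A (homog z) = (A (homog z)).2 *: homog z.
Proof. by move=> LA z1 E; rewrite {1}(lorentz_homogE LA z1) E. Qed.

(** The form h is positive definite on the orthogonal complement of two
  distinct isotropic lines. *)
Lemma isotropic_orthogonal (V : 'rV[R[i]]_d * R[i]) : x <> y ->
  hform V V = 0 -> hform V (homog x) = 0 -> hform V (homog y) = 0 -> V = 0.
Proof.
move=> xy VV Vx Vy.
have vx : dot V.1 x = V.2.
  have := Vx; rewrite -[hform _ _]/(dot V.1 x - V.2 * 1^*%C) conjc1 mulr1.
  by move=> /eqP; rewrite subr_eq0 => /eqP.
have vv : dot V.1 V.1 = V.2 * (V.2)^*%C.
  by have := VV; rewrite /hform => /eqP; rewrite subr_eq0 => /eqP.
have v1 : V.1 = V.2 *: x.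
  apply/eqP; rewrite -subr_eq0 -enorm_eq0 -sqrf_eq0; apply/eqP/complexI.
  rewrite -dotxx dotBl !dotBr !dotZl !dotZr -(dotJ V.1 x) vx vv dotxx x1.
  by rewrite expr1n rmorph1 rmorph0; ring.
have VE : V = V.2 *: homog x.
  by rewrite [LHS]surjective_pairing v1 /homog; congr (_, _); exact: (esym (mulr1 _)).
have := Vy; rewrite VE hformZl => /eqP.
rewrite mulf_eq0 (negPf (hform_sphere_neq0 xy)) orbF => /eqP V0.
by rewrite V0 scale0r.
Qed.

(** For distinct unit vectors x and y, the value h(V, V) for the component V
  of X orthogonal to (x, 1) and (y, 1). *)
Definition chord_defect (X : 'rV[R[i]]_d * R[i]) : R[i] :=
  hform X X - hform X (homog y) * hform (homog x) X / hform (homog x) (homog y)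
            - hform X (homog x) * hform (homog y) X / hform (homog y) (homog x).

Lemma chord_defectZ c X : chord_defect (c *: X) = c * c^*%C * chord_defect X.
Proof. by rewrite /chord_defect !hformZl !hformZr; ring. Qed.

Lemma chord_defect_lorentz A (l k : R[i]) X : lorentz A -> x <> y ->
  A (homog x) = l *: homog x -> A (homog y) = k *: homog y ->
  chord_defect (A X) = chord_defect X.
Proof.
move=> LA xy Ax Ay; have lk := eigen_pair LA xy Ax Ay; have [_ iA] := LA.
have l0 : l != 0.
  by apply/eqP => E; move: lk; rewrite E mul0r => /eqP; rewrite eq_sym oner_eq0.
have k0 : k^*%C != 0.
  by apply/eqP => E; move: lk; rewrite E mulr0 => /eqP; rewrite eq_sym oner_eq0.
have hx Y : hform (A Y) (homog x) = (l^*%C)^-1 * hform Y (homog x).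
  by rewrite -(iA Y (homog x)) Ax hformZr mulKf // conjc_eq0.
have hy Y : hform (A Y) (homog y) = (k^*%C)^-1 * hform Y (homog y).
  by rewrite -(iA Y (homog y)) Ay hformZr mulKf.
have kE : k^*%C = l^-1 by rewrite -[RHS]mulr1 -lk mulKf.
have lE : l^*%C = k^-1 by rewrite -(conjcK k) kE fmorphV invrK.
rewrite /chord_defect iA -(hformJ (A X) (homog x)) -(hformJ (A X) (homog y)) hx hy.
rewrite -(hformJ X (homog x)) -(hformJ X (homog y)).
rewrite !rmorphM !fmorphV /= !conjcK kE lE.
have kn : k != 0 by rewrite -conjc_eq0.
have h1 := hform_sphere_neq0 xy.
have h2 : hform (homog y) (homog x) != 0 by rewrite -hformJ conjc_eq0.
by field; rewrite h1 h2 kn l0.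
Qed.

(** The defect only depends on X modulo (x, 1). *)
Lemma chord_defect_shift z : x <> y ->
  chord_defect (homog z) = chord_defect (z - x, 0).
Proof.
move=> xy; have -> : (z - x, 0) = homog z - homog x.
  by rewrite /homog; congr (_, _); rewrite /= subrr.
have h1 := hform_sphere_neq0 xy.
have h2 : hform (homog y) (homog x) != 0 by rewrite -hformJ conjc_eq0.
have hxx := hform_isotropic x1.
rewrite /chord_defect !hformBl !hformBr hxx.
by field; rewrite h1 h2.
Qed.

Lemma chord_defect_bound : x <> y -> exists2 C : R, 0 < C & forall v,
  cabs (chord_defect (v, 0)) <= C * enorm v ^+ 2.
Proof.
move=> xy; have h1 := hform_sphere_neq0 xy.
pose H := cabs (hform (homog x) (homog y)); have H0 : 0 < H by rewrite cabs_gt0.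
have H2 : cabs (hform (homog y) (homog x)) = H by rewrite -hformJ cabsJ.
exists (1 + 2 / H) => [|v]; first by rewrite addr_gt0 // divr_gt0.
have hv z : enorm z = 1 -> cabs (hform (v, 0) (homog z)) <= enorm v.
  move=> z1; rewrite /hform /= mul0r subr0; apply: le_trans (dot_le _ _) _.
  by rewrite z1 mulr1.
have vv : cabs (hform (v, 0) (v, 0)) = enorm v ^+ 2.
  by rewrite /hform /= mul0r subr0 dotxx cabs_real ger0_norm // sqr_ge0.
have prod (a b : R[i]) : cabs a <= enorm v -> cabs b <= enorm v ->
    cabs a * cabs b / H <= enorm v ^+ 2 / H.
  by move=> ha hb; rewrite ler_pM2r ?invr_gt0 // expr2 ler_pM ?cabs_ge0.
rewrite /chord_defect; apply: le_trans (le_normcD _ _) _.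
have := le_normcD (hform (v, 0) (v, 0))
  (- (hform (v, 0) (homog y) * hform (homog x) (v, 0) / hform (homog x) (homog y))).
rewrite !normcN !cabsM !cabsV H2 -/H vv.
rewrite -(hformJ _ (homog x)) -(hformJ _ (homog y)) !cabsJ.
have := prod _ _ (hv y y1) (hv x x1); have := prod _ _ (hv x x1) (hv y y1).
by rewrite [2 / H]mulrC; lra.
Qed.

(** The component of (z, 1) orthogonal to (x, 1) and (y, 1) vanishes by
  [isotropic_orthogonal], so (z, 1) = a (x, 1) + b (y, 1), and the last
  coordinates give a + b = 1. *)
Lemma chord_defect_eq0 z : x <> y -> chord_defect (homog z) = 0 ->
  exists u : R[i], z = x + u *: (y - x).
Proof.
move=> xy z0; have h1 := hform_sphere_neq0 xy.
have h2 : hform (homog y) (homog x) != 0 by rewrite -hformJ conjc_eq0.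
have hxx := hform_isotropic x1; have hyy := hform_isotropic y1.
pose a := hform (homog z) (homog y) / hform (homog x) (homog y).
pose b := hform (homog z) (homog x) / hform (homog y) (homog x).
pose V := homog z - a *: homog x - b *: homog y.
have aJ : a^*%C = hform (homog y) (homog z) / hform (homog y) (homog x).
  by rewrite /a rmorphM fmorphV /= !hformJ.
have bJ : b^*%C = hform (homog x) (homog z) / hform (homog x) (homog y).
  by rewrite /b rmorphM fmorphV /= !hformJ.
have V0 : V = 0.
  apply: isotropic_orthogonal => //.
  - rewrite -z0 /V /chord_defect !hformBl !hformBr !hformZl !hformZr aJ bJ hxx hyy /a /b.
    by field; rewrite h1 h2.
  - by rewrite /V !hformBl !hformZl hxx /b; field.
  - by rewrite /V !hformBl !hformZl hyy /a; field.
exists b; have := congr1 (fun X => X.2) V0; have := congr1 (fun X => X.1) V0.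
rewrite /V /homog /= => z1 t1.
have ab : a = 1 - b.
  have : 1 - a * 1 - b * 1 = 0 := t1.
  by rewrite !mulr1 => E; rewrite -[RHS]subr0 -E; ring.
apply/rowP => j; move/rowP: z1 => /(_ j); rewrite ab !mxE => E.
by rewrite -[LHS]subr0 -E; ring.
Qed.

End SpherePair.

Section StepBounds.
Variables (R : realType) (d : nat) (B : 'rV[R[i]]_d * R[i] -> 'rV[R[i]]_d * R[i]).
Hypothesis LB : lorentz B.
Variables (w xi : 'rV[R[i]]_d) (l : R[i]) (e : R).
Hypotheses (w1 : uball d w) (xi1 : enorm xi = 1) (Bxi : B (homog xi) = l *: homog xi).

Lemma hform_homog_sphere (v : 'rV[R[i]]_d) :
  cabs (hform (homog v) (homog xi)) <= enorm (v - xi).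
Proof.
have -> : hform (homog v) (homog xi) = dot (v - xi) xi.
  by rewrite hform_homog dotBl dotxx xi1 expr1n rmorph1.
by apply: le_trans (dot_le _ _) _; rewrite xi1 mulr1.
Qed.

(** Since B preserves h and (xi, 1) is an eigenvector, h((w, 1), (xi, 1)) is
  the same number at the image w' up to the factor conj l and the last
  coordinate s of B (w, 1); and |s|^2 (1 - |w'|^2) = 1 - |w|^2. *)
Lemma forward_bound (w' := dehomog (B (homog w))) :
  enorm (w' - xi) ^+ 2 <= e * (1 - enorm w' ^+ 2) ->
  cabs (hform (homog w) (homog xi)) ^+ 2 <= cabs l ^+ 2 * (e * (1 - enorm w ^+ 2)).
Proof.
move=> we; have [_ iB] := LB.
rewrite -(iB (homog w) (homog xi)) Bxi (lorentz_homogE LB (ltW w1)) -/w'.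
rewrite hformZl hformZr !cabsM cabsJ (lorentz_norm LB (ltW w1)) -/w'.
have h2 : cabs (hform (homog w') (homog xi)) ^+ 2 <= enorm (w' - xi) ^+ 2.
  by rewrite ler_sqr ?nnegrE ?cabs_ge0 ?enorm_ge0 // hform_homog_sphere.
have := ler_wpM2l (mulr_ge0 (sqr_ge0 (cabs l)) (sqr_ge0 (cabs (B (homog w)).2)))
  (le_trans h2 we).
by rewrite !exprMn; lra.
Qed.

(** The same computation as in [forward_bound], with xi close to the starting
  point instead of its image. *)
Lemma backward_bound (w' := dehomog (B (homog w))) :
  enorm (w - xi) ^+ 2 <= e * (1 - enorm w ^+ 2) ->
  cabs l ^+ 2 * cabs (hform (homog w') (homog xi)) ^+ 2 <= e * (1 - enorm w' ^+ 2).
Proof.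
move=> we; have [_ iB] := LB.
have h2 : cabs (hform (homog w) (homog xi)) ^+ 2 <= enorm (w - xi) ^+ 2.
  by rewrite ler_sqr ?nnegrE ?cabs_ge0 ?enorm_ge0 // hform_homog_sphere.
have := le_trans h2 we.
rewrite -(iB (homog w) (homog xi)) Bxi (lorentz_homogE LB (ltW w1)) -/w'.
rewrite hformZl hformZr !cabsM cabsJ (lorentz_norm LB (ltW w1)) -/w'.
have s0 : 0 < cabs (B (homog w)).2 ^+ 2.
  by rewrite exprn_gt0 // cabs_gt0; apply: lorentz_homog_neq0 => //; exact: ltW.
rewrite !exprMn => H; rewrite -(ler_pM2l s0); lra.
Qed.

(** The defect is invariant under B, quadratic in scalars, and of order |w' -
  xi|^2 at w'. *)
Lemma defect_bound (eta : 'rV[R[i]]_d) (k : R[i]) (C : R) (w' := dehomog (B (homog w))) :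
  xi <> eta -> enorm eta = 1 -> B (homog eta) = k *: homog eta ->
  0 <= C -> (forall v, cabs (chord_defect xi eta (v, 0)) <= C * enorm v ^+ 2) ->
  enorm (w' - xi) ^+ 2 <= e * (1 - enorm w' ^+ 2) ->
  cabs (chord_defect xi eta (homog w)) <= C * (e * (1 - enorm w ^+ 2)).
Proof.
move=> xe eta1 Beta C0 CP we.
rewrite -(chord_defect_lorentz xi1 eta1 (homog w) LB xe Bxi Beta).
rewrite (lorentz_homogE LB (ltW w1)) -/w' chord_defectZ (chord_defect_shift xi1 eta1 _ xe).
rewrite !cabsM cabsJ (lorentz_norm LB (ltW w1)) -/w' -expr2.
have := ler_wpM2l (sqr_ge0 (cabs (B (homog w)).2))
   (le_trans (CP (w' - xi)) (ler_wpM2l C0 we)).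
by lra.
Qed.

End StepBounds.

(** * Multipliers of the image of an axis *)

Section Dynamics.
Variables (R : realType) (m n : nat) (alpha c : R).
Variables (f : 'rV[R[i]]_m -> 'rV[R[i]]_n).
Hypotheses (halpha : 2^-1 < alpha) (f_hoelder : hoelder_on alpha (cuball m) f).
Hypotheses (c0 : 0 < c)
  (f_schwarz : forall z, uball m z -> c * (1 - enorm z ^+ 2) <= 1 - enorm (f z) ^+ 2).

(** The key estimate: along the orbit of z, which is the pencil at the powers
  of l, the distance of f to f(p) is negligible with respect to the square
  root of 1 - |f|^2. *)
Lemma orbit_approaches (p q : 'rV[R[i]]_m) (a b l : R[i]) (z : 'rV[R[i]]_m) (e : R) :
  enorm p = 1 -> enorm q = 1 -> uball m z -> homog z = a *: homog p + b *: homog q ->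
  1 < cabs l -> 0 < e ->
  exists k, let X := (a * l ^+ k) *: homog p + (b * ((l ^+ k)^*%C)^-1) *: homog q in
    [/\ X.2 != 0, uball m (dehomog X) &
    enorm (f (dehomog X) - f p) ^+ 2 <= e * (1 - enorm (f (dehomog X)) ^+ 2)].
Proof.
move=> p1 q1 z1 zE l1 e0.
pose eta := 1 - enorm z ^+ 2.
have eta0 : 0 < eta by rewrite subr_gt0 expr_lt1 // enorm_ge0.
have zz : hform (homog z) (homog z) = (- eta)%:C%C.
  by rewrite hform_homog_self /eta opprB.
have a0 : a != 0.
  apply/eqP => a0; have : hform (homog z) (homog z) = 0.
    by rewrite zE a0 scale0r add0r hformZl hformZr (hform_isotropic q1) !mulr0.
  rewrite zz -(rmorph0 (real_complex R)) => /complexI /eqP.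
  by rewrite oppr_eq0 gt_eqF.
have pN : hform ((a * 1) *: homog p + (b * (1^*%C)^-1) *: homog q)
                ((a * 1) *: homog p + (b * (1^*%C)^-1) *: homog q) = (- eta)%:C%C.
  by rewrite conjc1 invr1 !mulr1 -zE.
have [C C0 CP] := pencil_attracted p1 q1 eta0 pN.
have [t t0 tP] := hoelder_small halpha f_hoelder c0 f_schwarz p1 C0 e0.
have [N NP] := pencil_to_boundary p1 q1 eta0 pN a0 t0.
have [k kN] := expr_unbounded N l1.
have mu0 : l ^+ k != 0.
  by rewrite expf_neq0 // -cabs_gt0; exact: lt_trans l1.
have [mu1 mut] : 1 <= cabs (l ^+ k) /\ _ := NP (l ^+ k) ltac:(by rewrite cabsX).
exists k; split.
- exact: (pencil2_neq0 p1 q1 eta0 pN mu0).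
- exact: (pencil_ball p1 q1 eta0 pN mu0).
- apply: tP => //; first exact: (pencil_ball p1 q1 eta0 pN mu0).
  exact: CP.
Qed.

Variables (A : 'rV[R[i]]_m * R[i] -> 'rV[R[i]]_m * R[i])
          (B : 'rV[R[i]]_n * R[i] -> 'rV[R[i]]_n * R[i]).
Hypotheses (LA : lorentz A) (LB : lorentz B).
Hypothesis f_ball : forall z, uball m z -> uball n (f z).
Hypothesis f_equiv : forall z, uball m z ->
  f (dehomog (A (homog z))) = dehomog (B (homog (f z))).

Lemma equivariant_iter k z : uball m z ->
  f (dehomog (iter k A (homog z))) = dehomog (iter k B (homog (f z))).
Proof.
move=> z1; elim: k => [|k IH]; first by rewrite /= !homogK.
have zk : uball m (dehomog (iter k A (homog z))) by apply: lorentz_ball => //; exact: lorentz_iter.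
have nA : (iter k A (homog z)).2 != 0.
  by apply: lorentz_homog_neq0; [exact: lorentz_iter | exact: ltW].
have nB : (iter k B (homog (f z))).2 != 0.
  by apply: lorentz_homog_neq0; [exact: lorentz_iter | apply: ltW; exact: f_ball].
rewrite !iterS -(dehomog_lorentz LA nA) f_equiv // IH; exact: dehomog_lorentz.
Qed.

Variables (p q : 'rV[R[i]]_m) (la ka : R[i]) (lb kb : R[i]).
Hypotheses (p1 : enorm p = 1) (q1 : enorm q = 1) (pq : p <> q).
Hypotheses (Ap : A (homog p) = la *: homog p) (Aq : A (homog q) = ka *: homog q).
Hypothesis la1 : 1 < cabs la.
Hypotheses (fp1 : enorm (f p) = 1) (fq1 : enorm (f q) = 1).
Hypotheses (Bp : B (homog (f p)) = lb *: homog (f p)) (Bq : B (homog (f q)) = kb *: homog (f q)).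

Let la_neq0 : la != 0. Proof. by rewrite -cabs_gt0; exact: lt_trans la1. Qed.

Let kaE : ka = (la^*%C)^-1.
Proof.
have := eigen_pair p1 q1 LA pq Ap Aq => lk.
by rewrite -(conjcK ka) -fmorphV; congr (_^*%C); rewrite -[RHS]mulr1 -lk mulKf.
Qed.

Lemma forward_orbit z (a b : R[i]) (e : R) : uball m z ->
  homog z = a *: homog p + b *: homog q -> 0 < e ->
  exists k, let w' := dehomog (iter k B (homog (f z))) in
    enorm (w' - f p) ^+ 2 <= e * (1 - enorm w' ^+ 2).
Proof.
move=> z1 zE e0; have [k [X0 X1 XP]] := orbit_approaches p1 q1 z1 zE la1 e0.
exists k; rewrite /= -equivariant_iter //.
have -> : iter k A (homog z) =
    (a * la ^+ k) *: homog p + (b * ((la ^+ k)^*%C)^-1) *: homog q.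
  have Lk := lorentz_iter k LA.
  rewrite zE (lorentzD _ _ Lk) !(lorentzZ _ _ Lk) (eigen_iter k LA Ap) (eigen_iter k LA Aq).
  by rewrite !scalerA kaE exprVn rmorphXn.
exact: XP.
Qed.

(** The roles of p and q exchanged: the point of the pencil with parameter
  (conj l)^k at q is mapped to z by the k-th iterate of A. *)
Lemma backward_orbit z (a b : R[i]) (e : R) : uball m z ->
  homog z = a *: homog p + b *: homog q -> 0 < e ->
  exists k y, [/\ uball m y, f z = dehomog (iter k B (homog (f y))) &
    enorm (f y - f q) ^+ 2 <= e * (1 - enorm (f y) ^+ 2)].
Proof.
move=> z1 zE e0; have lJ : 1 < cabs (la^*%C) by rewrite cabsJ.
have zE' : homog z = b *: homog q + a *: homog p by rewrite addrC.
have [k] := orbit_approaches q1 p1 z1 zE' lJ e0.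
set X := _ + _ => -[X0 X1 XP]; exists k, (dehomog X); split => //.
rewrite -equivariant_iter // dehomog_lorentz //; last exact: lorentz_iter.
suff -> : iter k A X = homog z by rewrite homogK.
have Lk := lorentz_iter k LA.
rewrite /X (lorentzD _ _ Lk) !(lorentzZ _ _ Lk) (eigen_iter k LA Ap) (eigen_iter k LA Aq).
have ln : la ^+ k != 0 by rewrite expf_neq0.
have lJn : (la ^+ k)^*%C != 0 by rewrite conjc_eq0.
rewrite !scalerA kaE exprVn -!rmorphXn /= conjcK -!mulrA mulVf // mulfV //.
by rewrite !mulr1.
Qed.

Let mid : 'rV[R[i]]_m := (2^-1 : R[i]) *: (p + q).
Let mid1 : uball m mid. Proof. exact: midpoint_ball. Qed.
Let midE : homog mid = (2^-1 : R[i]) *: homog p + (2^-1 : R[i]) *: homog q.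
Proof.
rewrite /homog /mid scalerDr; congr (_, _) => /=.
by rewrite -[_ *: 1]/(2^-1 * 1); field.
Qed.

Lemma hform_ball_sphere d (w x : 'rV[R[i]]_d) : uball d w -> enorm x = 1 ->
  0 < cabs (hform (homog w) (homog x)) ^+ 2.
Proof.
move=> w1 x1; rewrite exprn_gt0 // cabs_gt0 hform_homog subr_eq0.
apply/eqP => E; have := dot_le w x; rewrite E ComplexField.Normc.normc1 x1 mulr1.
by rewrite leNgt w1.
Qed.

Let one_sub_le1 d (w : 'rV[R[i]]_d) : 1 - enorm w ^+ 2 <= 1.
Proof. by rewrite gerBl sqr_ge0. Qed.

(** By [forward_bound], |h((w, 1), (f p, 1))|^2 <= |lb|^(2 k) e (1 - |w|^2)
  with e arbitrary; if |lb| <= 1 the left-hand side would vanish, but f(p) is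
  on the sphere and w inside. *)
Lemma attracting_multiplier : 1 < cabs lb.
Proof.
rewrite ltNge; apply/negP => lb1; have w1 := f_ball mid1.
have g0 := hform_ball_sphere w1 fp1.
set g := cabs _ ^+ 2 in g0.
have g2 : 0 < g / 2 by rewrite divr_gt0.
have [k kP] := forward_orbit mid1 midE g2.
have := forward_bound (lorentz_iter k LB) w1 fp1 (eigen_iter k LB Bp) kP.
rewrite -/g cabsX leNgt => /negP; apply.
have h1 : cabs lb ^+ k ^+ 2 <= 1.
  by rewrite expr_le1 ?exprn_ge0 ?cabs_ge0 // exprn_ile1 ?cabs_ge0.
have h2 : 0 <= g / 2 * (1 - enorm (f mid) ^+ 2).
  by rewrite mulr_ge0 ?(ltW g2) // subr_ge0 expr_le1 ?enorm_ge0 // ltW.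
have h3 : g / 2 * (1 - enorm (f mid) ^+ 2) <= g / 2.
  by rewrite ler_piMr ?(ltW g2) ?one_sub_le1.
have : cabs lb ^+ k ^+ 2 * (g / 2 * (1 - enorm (f mid) ^+ 2)) <=
   g / 2 * (1 - enorm (f mid) ^+ 2) by rewrite ler_piMl.
by move: h3 g0; move: (g / 2 * _) => u; lra.
Qed.

(** By [backward_bound], |kb|^(2 k) |h((w, 1), (f q, 1))|^2 <= e (1 - |w|^2)
  with e arbitrary, which excludes |kb| >= 1. *)
Lemma repelling_multiplier : cabs kb < 1.
Proof.
rewrite ltNge; apply/negP => kb1; have w1 := f_ball mid1.
have g0 := hform_ball_sphere w1 fq1.
set g := cabs _ ^+ 2 in g0.
have g2 : 0 < g / 2 by rewrite divr_gt0.
have [k [y [y1 yE yP]]] := backward_orbit mid1 midE g2.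
have := backward_bound (lorentz_iter k LB) (f_ball y1) fq1 (eigen_iter k LB Bq) yP.
rewrite -yE -/g cabsX leNgt => /negP; apply.
have h3 : g / 2 * (1 - enorm (f mid) ^+ 2) <= g / 2.
  by rewrite ler_piMr ?(ltW g2) ?one_sub_le1.
have h1 : 1 <= cabs kb ^+ k ^+ 2 by rewrite exprn_ege1 // exprn_ege1.
have h4 : g <= cabs kb ^+ k ^+ 2 * g by rewrite ler_peMl // ltW.
by move: h3 h4 g0; lra.
Qed.

(** By [defect_bound] the defect of w = f(z) is at most e for every e, so it
  vanishes. *)
Lemma axis_image_ball z (a b : R[i]) : f p <> f q -> uball m z ->
  homog z = a *: homog p + b *: homog q -> exists u : R[i], f z = f p + u *: (f q - f p).
Proof.
move=> fpq z1 zE; have w1 := f_ball z1.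
apply: (chord_defect_eq0 fp1 fq1 fpq); apply/eqP; rewrite -cabs_eq0 eq_le cabs_ge0 andbT.
have [C C0 CP] := chord_defect_bound fp1 fq1 fpq.
apply/ler_addgt0Pr => e e0; rewrite add0r.
have [k kP] := forward_orbit z1 zE (divr_gt0 e0 C0).
have := defect_bound (lorentz_iter k LB) w1 fp1 (eigen_iter k LB Bp) fpq fq1
  (eigen_iter k LB Bq) (ltW C0) CP kP.
move=> h; apply: le_trans h _.
rewrite mulrA mulrCA mulfV ?gt_eqF // mulr1.
by rewrite ler_piMr ?one_sub_le1 // ltW.
Qed.

End Dynamics.

(** * Boundary values and affine lines *)

Section BoundaryExtension.
Variables (R : realType) (m n : nat) (alpha : R) (f : 'rV[R[i]]_m -> 'rV[R[i]]_n).
Hypotheses (alpha0 : 0 < alpha) (f_hoelder : hoelder_on alpha (cuball m) f).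

Lemma hoelder_continuous (e : R) : 0 < e -> exists2 t : R, 0 < t &
  forall x y, cuball m x -> cuball m y -> enorm (x - y) <= t -> enorm (f x - f y) <= e.
Proof.
move=> e0; have [h hP] := f_hoelder.
have H0 : 0 < `|h| + 1 by rewrite ltr_wpDl.
have [t t0 tP] := powR_small alpha0 (divr_gt0 e0 H0).
exists t => // x y x1 y1 xy; apply: le_trans (hP x y x1 y1) _.
have xyt : enorm (x - y) `^ alpha <= e / (`|h| + 1) by apply: tP; rewrite enorm_ge0.
apply: le_trans (_ : `|h| * (e / (`|h| + 1)) <= e).
  by apply: le_trans (ler_wpM2r (powR_ge0 _ _) (ler_norm h)) _; rewrite ler_wpM2l.
rewrite mulrCA ler_piMr ?(ltW e0) // ler_pdivrMr // mul1r; lra.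
Qed.

(** Otherwise x would be in the closure of the preimage of a closed ball
  inside the unit ball, which is compact by properness. *)
Lemma proper_boundary x : set_fun (cuball m) (cuball n) f ->
  proper_map (uball m) (uball n) f -> enorm x = 1 -> enorm (f x) = 1.
Proof.
move=> f_cball f_proper x1; have xc : cuball m x by rewrite /cuball /= x1.
have fx1 : enorm (f x) <= 1 by exact: f_cball.
apply/eqP; rewrite eq_le fx1 leNgt; apply/negP => fxlt.
pose r := (1 + enorm (f x)) / 2.
have r1 : r < 1 by rewrite /r; lra.
have cK : compact [set w : 'rV[R[i]]_n | enorm w <= r] by exact: compact_cuball.
have KB : [set w : 'rV[R[i]]_n | enorm w <= r] `<=` uball n.
  by move=> w /= wr; exact: le_lt_trans r1.
have cS := compact_closed (@norm_hausdorff _ _) (f_proper _ KB cK).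
have : (uball m `&` f @^-1` [set w | enorm w <= r]) x.
  apply: cS => P /nbhs_enormP[s s0 sP].
  have e0 : 0 < (1 - enorm (f x)) / 2 by lra.
  have [t t0 tP] := hoelder_continuous e0.
  have st0 : 0 < Num.min s t by rewrite lt_min s0.
  have [y [y1 yx]] := uball_dense xc st0.
  rewrite lt_min in yx; have /andP[ys yt] := yx.
  exists y; split; last exact: sP.
  split => //=; have fyx := tP y x (ltW y1) xc (ltW yt).
  have := enormD (f y - f x) (f x); rewrite subrK /r; lra.
by case; rewrite /uball /= x1 ltxx.
Qed.

(** The relation between f and the two automorphisms passes to the limit along
  points of the ball approaching x. *)
Lemma boundary_equivariant A B x : lorentz A -> lorentz B ->
  set_fun (uball m) (uball n) f -> set_fun (cuball m) (cuball n) f ->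
  (forall z, uball m z -> f (dehomog (A (homog z))) = dehomog (B (homog (f z)))) ->
  enorm x <= 1 -> dehomog (A (homog x)) = x -> dehomog (B (homog (f x))) = f x.
Proof.
move=> LA LB f_ball f_cball f_equiv x1 Ax.
apply/eqP; rewrite -subr_eq0 -enorm_eq0 eq_le enorm_ge0 andbT.
apply/ler_addgt0Pr => e e0; rewrite add0r.
have e2 : 0 < e / 2 by rewrite divr_gt0.
have fx1 : enorm (f x) <= 1 by exact: f_cball.
have [rB rB0 rBP] := lorentz_cvg LB fx1 e2.
have [t1 t10 t1P] := hoelder_continuous e2.
have rB2 : 0 < rB / 2 by rewrite divr_gt0.
have [t2 t20 t2P] := hoelder_continuous rB2.
have [rA rA0 rAP] := lorentz_cvg LA x1 t10.
have r0 : 0 < Num.min rA t2 by rewrite lt_min rA0.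
have [y [y1 yx]] := uball_dense x1 r0.
rewrite lt_min in yx; have /andP[yA yt] := yx.
have yc : cuball m y by exact: ltW.
have Ay : cuball m (dehomog (A (homog y))) by apply: ltW; exact: lorentz_ball.
have h1 := rAP y (ltW y1) yA; rewrite Ax in h1.
have h2 := t1P _ _ Ay x1 (ltW h1); rewrite f_equiv // in h2.
have h3 : enorm (f y - f x) < rB.
  by apply: le_lt_trans (t2P _ _ yc x1 (ltW yt)) _; lra.
have h4 := rBP (f y) (f_cball y yc) h3.
have -> : dehomog (B (homog (f x))) - f x =
  (dehomog (B (homog (f y))) - f x) - (dehomog (B (homog (f y))) - dehomog (B (homog (f x)))).
  by rewrite [RHS]addrC opprB addrA subrK.
by have := enormBD (dehomog (B (homog (f y))) - f x)
  (dehomog (B (homog (f y))) - dehomog (B (homog (f x)))); lra.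
Qed.

End BoundaryExtension.

(** The distance to the line is estimated through the explicit residual after
  projection to the direction y - x, which vanishes on the line and is
  2-Lipschitz. *)
Lemma line_closed (R : realType) (d : nat) (x y v : 'rV[R[i]]_d) : x <> y ->
  (forall e : R, 0 < e -> exists u : R[i], enorm (v - (x + u *: (y - x))) <= e) ->
  exists u : R[i], v = x + u *: (y - x).
Proof.
move=> xy vP; pose w := y - x.
have w0 : 0 < enorm w.
  by rewrite lt_def enorm_ge0 enorm_eq0 subr_eq0 andbT eq_sym; apply/eqP.
have ww : dot w w != 0.
  by rewrite dotxx -(rmorph0 (real_complex R)) (inj_eq (@complexI R)) sqrf_eq0 gt_eqF.
exists (dot (v - x) w / dot w w); apply/eqP; rewrite -subr_eq0 -enorm_eq0.
rewrite eq_le enorm_ge0 andbT; apply/ler_addgt0Pr => e e0; rewrite add0r.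
have [u uP] := vP (e / 2) ltac:(by rewrite divr_gt0); rewrite -/w in uP *.
pose g := v - (x + u *: w).
have -> : v - (x + (dot (v - x) w / dot w w) *: w) = g - (dot g w / dot w w) *: w.
  have gE : g = v - x - u *: w by rewrite /g opprD addrA.
  have -> : dot g w = dot (v - x) w - u * dot w w by rewrite gE (dotBl (v - x)) dotZl.
  by rewrite gE mulrBl mulfK // scalerBl opprB opprD !addrA subrK.
apply: le_trans (enormBD _ _) _; rewrite enormZ cabsM cabsV.
have -> : cabs (dot w w) = enorm w ^+ 2 by rewrite dotxx cabs_real ger0_norm ?sqr_ge0.
have h : cabs (dot g w) / enorm w ^+ 2 * enorm w <= enorm g.
  rewrite mulrAC ler_pdivrMr ?exprn_gt0 // expr2 mulrA ler_pM2r //; exact: dot_le.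
by move: h uP; rewrite -/g; lra.
Qed.

Lemma affine_line_through (R : realType) (d : nat) (L : set 'rV[R[i]]_d) (x y : 'rV[R[i]]_d) :
  complex_affine_line L -> x <> y -> L x -> L y ->
  forall z, L z <-> exists u : R[i], z = x + u *: (y - x).
Proof.
move=> [a [b [b0 ->]]] xy [t1 _ xE] [t2 _ yE] z.
have t12 : t2 - t1 != 0.
  by rewrite subr_eq0; apply/eqP => E; apply: xy; rewrite -xE -yE E.
have wE : y - x = (t2 - t1) *: b.
  by rewrite -xE -yE scalerBl opprD addrACA subrr add0r.
split=> [[t _ <-]|[u ->]].
  exists ((t - t1) / (t2 - t1)); rewrite wE scalerA divfK // -xE.
  by rewrite scalerBl -addrA subrKC.
exists (t1 + u * (t2 - t1)) => //.
by rewrite wE scalerA -xE scalerDl addrA.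
Qed.

(** The axis is defined by choice among the lines containing the fixed points;
  two distinct points determine it. *)
Lemma axisP (R : realType) (d : nat) (g : 'rV[R[i]]_d -> 'rV[R[i]]_d) (x y : 'rV[R[i]]_d) :
  x <> y -> bdry_fix g = [set x; y] ->
  forall z, axis g z <-> exists u : R[i], z = x + u *: (y - x).
Proof.
move=> xy gE.
have : exists L, complex_affine_line L /\ bdry_fix g `<=` L.
  exists [set x + t *: (y - x) | t in [set: R[i]]]; split.
    by exists x, (y - x); split=> // /eqP; rewrite subr_eq0 eq_sym => /eqP.
  rewrite gE => z [->|->]; first by exists 0; rewrite // scale0r addr0.
  by exists 1; rewrite // scale1r subrKC.
move=> /getPex; rewrite -/(axis g) => -[Lg gL].
by apply: affine_line_through => //; apply: gL; rewrite gE; [left|right].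
Qed.

(** * The axis of a loxodromic automorphism *)

Section AttractingAxis.
Variables (R : realType) (m n : nat) (alpha : R) (f : 'rV[R[i]]_m -> 'rV[R[i]]_n).
Hypotheses (halpha : 2^-1 < alpha) (f_hoelder : hoelder_on alpha (cuball m) f).
Hypotheses (f_ball : set_fun (uball m) (uball n) f) (f_holo : holomorphic_on (uball m) f).
Hypotheses (f_proper : proper_map (uball m) (uball n) f).
Hypothesis f_cball : set_fun (cuball m) (cuball n) f.
Variables (A : 'rV[R[i]]_m * R[i] -> 'rV[R[i]]_m * R[i])
          (B : 'rV[R[i]]_n * R[i] -> 'rV[R[i]]_n * R[i]).
Hypotheses (LA : lorentz A) (LB : lorentz B).
Hypothesis f_equiv : forall z, uball m z ->
  f (dehomog (A (homog z))) = dehomog (B (homog (f z))).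
Variables (p q : 'rV[R[i]]_m) (la ka : R[i]).
Hypotheses (p1 : enorm p = 1) (q1 : enorm q = 1) (pq : p <> q).
Hypotheses (Ap : A (homog p) = la *: homog p) (Aq : A (homog q) = ka *: homog q).
Hypothesis la1 : 1 < cabs la.

Let alpha0 : 0 < alpha. Proof. by apply: lt_trans halpha; rewrite invr_gt0. Qed.
Let la0 : la != 0. Proof. by rewrite -cabs_gt0; exact: lt_trans la1. Qed.
Let ka0 : ka != 0.
Proof.
apply/eqP => k0; have := eigen_pair p1 q1 LA pq Ap Aq.
by rewrite k0 conjc0 mulr0 => /eqP; rewrite eq_sym oner_eq0.
Qed.

(** The points of the axis inside the ball are covered by [axis_image_ball].
  A point z of the sphere is the limit of the points of the segment from z to
  the midpoint of p and q, which lie in the ball and on the axis, and the line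
  through f(p) and f(q) is closed. *)
Lemma image_of_axis : [/\ enorm (f p) = 1, enorm (f q) = 1, f p <> f q,
   exists2 lb, 1 < cabs lb & B (homog (f p)) = lb *: homog (f p) &
   exists2 kb, cabs kb < 1 & B (homog (f q)) = kb *: homog (f q)] /\
  forall u : R[i], enorm (p + u *: (q - p)) <= 1 ->
    exists v : R[i], f (p + u *: (q - p)) = f p + v *: (f q - f p).
Proof.
have fp1 := proper_boundary alpha0 f_hoelder f_cball f_proper p1.
have fq1 := proper_boundary alpha0 f_hoelder f_cball f_proper q1.
have [c c0 cP] := schwarz_boundary_estimate f_holo f_ball.
have fixp : dehomog (A (homog p)) = p by rewrite Ap dehomogZ // homogK.
have fixq : dehomog (A (homog q)) = q by rewrite Aq dehomogZ // homogK.
have bdry x : enorm x = 1 -> dehomog (A (homog x)) = x -> enorm (f x) = 1 ->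
    B (homog (f x)) = (B (homog (f x))).2 *: homog (f x).
  move=> x1 Ax fx1; apply: fixed_eigen => //; first by rewrite fx1.
  apply: (boundary_equivariant alpha0 f_hoelder LA LB) => //.
  by rewrite x1.
have Bp := bdry p p1 fixp fp1; have Bq := bdry q q1 fixq fq1.
set lb := (B (homog (f p))).2 in Bp; set kb := (B (homog (f q))).2 in Bq.
have lb1 : 1 < cabs lb := attracting_multiplier halpha f_hoelder c0 cP LA LB
   f_ball f_equiv p1 q1 pq Ap Aq la1 fp1 Bp.
have kb1 : cabs kb < 1 := repelling_multiplier halpha f_hoelder c0 cP LA LB
   f_ball f_equiv p1 q1 pq Ap Aq la1 fq1 Bq.
have fpq : f p <> f q.
  by move=> E; move: kb1; rewrite /kb -E -/lb ltNge (ltW lb1).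
split; first by split=> //; [exists lb | exists kb].
have interior z : uball m z -> (exists u : R[i], z = p + u *: (q - p)) ->
    exists v : R[i], f z = f p + v *: (f q - f p).
  move=> z1 [u zE]; have zl : homog z = (1 - u) *: homog p + u *: homog q.
    rewrite zE /homog; congr (_, _) => /=.
      by rewrite scalerBr scalerBl scale1r addrA addrAC.
    by rewrite -[(1 - u) *: _]/((1 - u) * 1) -[u *: _]/(u * 1) !mulr1 subrK.
  exact: (axis_image_ball halpha f_hoelder c0 cP LA LB
   f_ball f_equiv p1 q1 pq Ap Aq la1 fp1 fq1 Bp Bq fpq z1 zl).
move=> u z1; set z := p + _ in z1 *; apply: line_closed => // e e0.
have [t t0 tP] := hoelder_continuous alpha0 f_hoelder e0.
pose mid : 'rV[R[i]]_m := (2^-1 : R[i]) *: (p + q).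
have mid1 : uball m mid by exact: midpoint_ball.
pose s := Num.min 1 (t / 2).
have s0 : 0 < s by rewrite lt_min ltr01 divr_gt0.
have s1 : s <= 1 by rewrite ge_min lexx.
have st : s <= t / 2 by rewrite ge_min lexx orbT.
pose y := z + s%:C%C *: (mid - z).
have y1 : uball m y.
  have -> : y = (1 - s)%:C%C *: z + s%:C%C *: mid.
    by rewrite /y rmorphB rmorph1 scalerBl scale1r scalerBr addrA addrAC.
  rewrite /uball /=; apply: le_lt_trans (enormD _ _) _.
  rewrite (enormZ _ z) (enormZ _ mid) !cabs_real (ger0_norm (ltW s0)) ger0_norm ?subr_ge0 //.
  have : (1 - s) * enorm z <= 1 - s by rewrite ler_piMr // subr_ge0.
  have : s * enorm mid < s by rewrite gtr_pMr.
  by lra.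
have yline : exists v : R[i], y = p + v *: (q - p).
  exists (u + s%:C%C * (2^-1 - u)); rewrite /y /z /mid.
  by apply/rowP => j; rewrite !mxE; field.
have [v yE] := interior y y1 yline; exists v; rewrite -yE.
apply: (tP z y z1 (ltW y1)).
have -> : z - y = - (s%:C%C *: (mid - z)) by rewrite /y opprD addrA subrr add0r.
rewrite enormN (enormZ _ (mid - z)) cabs_real gtr0_norm //.
have mz : enorm (mid - z) <= 2.
  by have := enormBD mid z; have : enorm mid < 1 := mid1; lra.
have : s * enorm (mid - z) <= s * 2 by rewrite ler_pM2l.
by lra.
Qed.

End AttractingAxis.

Lemma bdry_fix_lorentz (R : realType) (d : nat) (g : 'rV[R[i]]_d -> 'rV[R[i]]_d) A x :
  lorentz A -> (forall z, uball d z -> g z = dehomog (A (homog z))) ->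
  bdry_fix g x <-> enorm x = 1 /\ dehomog (A (homog x)) = x.
Proof.
move=> LA gA; split=> -[x1 gx]; split=> //.
  by rewrite -(ball_ext_lorentz LA gA) // x1.
by rewrite (ball_ext_lorentz LA gA) // x1.
Qed.

Section HyperbolicPair.
Variables (R : realType) (d : nat) (g : 'rV[R[i]]_d -> 'rV[R[i]]_d).
Variables (A : 'rV[R[i]]_d * R[i] -> 'rV[R[i]]_d * R[i]).
Hypotheses (g_aut : ball_aut g) (LA : lorentz A).
Hypothesis gA : forall z, uball d z -> g z = dehomog (A (homog z)).
Variables (x y : 'rV[R[i]]_d) (l k : R[i]).
Hypotheses (x1 : enorm x = 1) (y1 : enorm y = 1) (xy : x <> y).
Hypotheses (Ax : A (homog x) = l *: homog x) (Ay : A (homog y) = k *: homog y).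

(** A third fixed boundary point would have an eigenvalue t with |t| |l| = 1 =
  |t| |k|.  A fixed point z in the ball would have an eigenvalue of modulus 1
  because h((z, 1), (z, 1)) is nonzero, and then |l| = 1 because h((z, 1), (x,
  1)) is nonzero. *)
Lemma loxodromic_of_multiplier : 1 < cabs l -> cabs k < 1 ->
  bdry_fix g = [set x; y] /\ loxodromic g.
Proof.
move=> l1 k1; have lk := eigen_pair x1 y1 LA xy Ax Ay.
have l0 : l != 0 by rewrite -cabs_gt0; exact: lt_trans l1.
have k0 : k != 0.
  by apply/eqP => E; move: lk; rewrite E conjc0 mulr0 => /eqP; rewrite eq_sym oner_eq0.
have gE : bdry_fix g = [set x; y].
  apply/seteqP; split=> [z|z].
    move=> /(bdry_fix_lorentz _ LA gA)[z1 Az].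
    have zle : enorm z <= 1 by rewrite z1.
    have Az' := fixed_eigen LA zle Az.
    set t := (A (homog z)).2 in Az'.
    apply: contrapT => /not_orP[zx zy].
    have := eigen_pair z1 x1 LA zx Az' Ax => /(congr1 (fun w => cabs w)).
    have := eigen_pair z1 y1 LA zy Az' Ay => /(congr1 (fun w => cabs w)).
    rewrite !cabsM !cabsJ ComplexField.Normc.normc1 => tk tl.
    have : cabs t * cabs k <= cabs t * cabs l.
      by rewrite ler_wpM2l ?cabs_ge0 // ltW // (lt_trans k1).
    have t0 : 0 < cabs t.
      by rewrite lt_def cabs_ge0 andbT; apply/eqP => E; move: tk; rewrite E mul0r; lra.
    have : cabs t * cabs k < cabs t * cabs l by rewrite ltr_pM2l // (lt_trans k1).
    by lra.
  by move=> [->|->]; apply/(bdry_fix_lorentz _ LA gA); rewrite ?Ax ?Ay dehomogZ // homogK.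
split=> //; split=> //; last by exists x, y.
move=> [z z1 gz]; have Az := fixed_eigen LA (ltW z1) (etrans (esym (gA z1)) gz).
have := lorentz_norm LA (ltW z1); rewrite -gA // gz => E.
have d0 : 0 < 1 - enorm z ^+ 2 by rewrite subr_gt0 expr_lt1 // enorm_ge0.
set t := (A (homog z)).2 in Az E.
have t1 : cabs t = 1.
  apply/eqP; rewrite -(@eqrXn2 _ 2) ?cabs_ge0 // expr1n.
  by apply/eqP/(mulIf (lt0r_neq0 d0)); rewrite -E mul1r.
have [_ iA] := LA; have := iA (homog z) (homog x).
rewrite Az Ax hformZl hformZr => /(congr1 (fun w => cabs w ^+ 2)).
have h0 := hform_ball_sphere z1 x1.
rewrite !cabsM cabsJ t1 mul1r exprMn => H.
have : cabs l ^+ 2 = 1 by apply: (mulIf (lt0r_neq0 h0)); rewrite H mul1r.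
by apply/eqP; rewrite gt_eqF // exprn_egt1.
Qed.

(** If |l| = 1 then l * conj k = 1 forces k = l, and the line through x and y
  is fixed pointwise. *)
Lemma multiplier_neq1 : ~ (exists2 z, uball d z & g z = z) -> cabs l != 1.
Proof.
move=> nofix; apply/eqP => l1; apply: nofix.
have lk := eigen_pair x1 y1 LA xy Ax Ay.
have l0 : l != 0 by rewrite -cabs_gt0 l1.
have kl : k = l.
  have ll : l * l^*%C = 1 by rewrite -sqr_normc normr_cabs l1 rmorph1 expr1n.
  by apply: (can_inj (@conjcK R)); apply: (mulfI l0); rewrite lk ll.
have mid1 := midpoint_ball x1 y1 xy.
exists ((2^-1 : R[i]) *: (x + y)) => //; rewrite gA //.
have midE : homog ((2^-1 : R[i]) *: (x + y)) = (2^-1 : R[i]) *: (homog x + homog y).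
  rewrite /homog; congr (_, _) => /=; apply: esym.
  by apply: mulVf; rewrite pnatr_eq0.
rewrite midE lorentzZ // lorentzD // Ax Ay kl -scalerDr scalerA mulrC -scalerA dehomogZ //.
by rewrite -midE homogK.
Qed.

End HyperbolicPair.

Unset Implicit Arguments.
Set Strict Implicit.
Set Printing Implicit Defensive.

Theorem theorem1p7 (R : realType) (m M : nat) (hm : (1 <= m)%N) (hM : (1 <= M)%N)
    (alpha : R) (halpha : 2^-1 < alpha)
    (f : 'rV[R[i]]_m -> 'rV[R[i]]_M)
    (f_ball : set_fun (uball m) (uball M) f)
    (f_holo : holomorphic_on (uball m) f)
    (f_proper : proper_map (uball m) (uball M) f)
    (f_cball : set_fun (cuball m) (cuball M) f)
    (f_hoelder : hoelder_on alpha (cuball m) f)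
    (phi : 'rV[R[i]]_m -> 'rV[R[i]]_m) (psi : 'rV[R[i]]_M -> 'rV[R[i]]_M)
    (phi_psi : symmetry_group f (phi, psi))
    (phi_lox : loxodromic phi) :
  loxodromic psi /\
  f @` (axis phi `&` cuball m) `<=` axis psi `&` cuball M.
Proof.
have [/= phi_aut psi_aut f_sym] := phi_psi.
have [_ phi_nofix [p0 [q0 [pq0 phi_fix0]]]] := phi_lox.
have [A LA phiA] := ball_aut_lorentz phi_aut.
have [B LB psiB] := ball_aut_lorentz psi_aut.
have f_equiv z : uball m z -> f (dehomog (A (homog z))) = dehomog (B (homog (f z))).
  move=> z1; rewrite -phiA // -psiB; last exact: f_ball.
  by rewrite f_sym ?ball_invK //; exact: ball_autW.
(* up to exchanging the two fixed points, the eigenvalue at p has modulus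
   greater than 1 *)
suff main p q : p <> q -> bdry_fix phi = [set p; q] -> 1 < cabs (A (homog p)).2 ->
    loxodromic psi /\ f @` (axis phi `&` cuball m) `<=` axis psi `&` cuball M.
  have fixed x : bdry_fix phi x -> enorm x = 1 /\ A (homog x) = (A (homog x)).2 *: homog x.
    move=> /(bdry_fix_lorentz _ LA phiA)[x1 Ax]; split=> //.
    by apply: fixed_eigen => //; rewrite x1.
  have [p1 Ap] : enorm p0 = 1 /\ A (homog p0) = (A (homog p0)).2 *: homog p0.
    by apply: fixed; rewrite phi_fix0; left.
  have [q1 Aq] : enorm q0 = 1 /\ A (homog q0) = (A (homog q0)).2 *: homog q0.
    by apply: fixed; rewrite phi_fix0; right.
  have [pgt|ple|peq] := ltgtP 1 (cabs (A (homog p0)).2).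
  - exact: (main p0 q0).
  - apply: (main q0 p0); [exact: nesym | by rewrite setUC | ].
    have := eigen_pair p1 q1 LA pq0 Ap Aq => /(congr1 (fun w => cabs w)).
    rewrite cabsM cabsJ ComplexField.Normc.normc1 => E.
    rewrite ltNge; apply/negP => qle.
    have : cabs (A (homog p0)).2 * cabs (A (homog q0)).2 <= cabs (A (homog p0)).2.
      by rewrite ler_piMr ?cabs_ge0.
    by rewrite E leNgt ple.
  - have := multiplier_neq1 LA phiA p1 q1 pq0 Ap Aq phi_nofix.
    by rewrite -peq eqxx.
move=> pq phi_fix la1.
have [p1 Ap] : enorm p = 1 /\ dehomog (A (homog p)) = p.
  by apply/(bdry_fix_lorentz _ LA phiA); rewrite phi_fix; left.
have [q1 Aq] : enorm q = 1 /\ dehomog (A (homog q)) = q.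
  by apply/(bdry_fix_lorentz _ LA phiA); rewrite phi_fix; right.
have p_le1 : enorm p <= 1 by rewrite p1.
have q_le1 : enorm q <= 1 by rewrite q1.
have [[fp1 fq1 fpq [lb lb1 Bp] [kb kb1 Bq]] f_axis] :=
  image_of_axis halpha f_hoelder f_ball f_holo f_proper f_cball LA LB f_equiv
    p1 q1 pq (fixed_eigen LA p_le1 Ap) (fixed_eigen LA q_le1 Aq) la1.
have [psi_fix psi_lox] :=
  loxodromic_of_multiplier psi_aut LB psiB fp1 fq1 fpq Bp Bq lb1 kb1.
split=> // _ [z [/(axisP pq phi_fix)[u zE] z1] <-]; split; last exact: f_cball.
by apply/(axisP fpq psi_fix); rewrite zE; apply: f_axis; rewrite -zE.
Qed.
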